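(* (i) If $\Theta_h=0$, then for all $t\ge0$: $$\widetilde{a}_2(t+N_hT_{hyp})=\widetilde{a}_2(t+T_{rev})=\widetilde{a}_2(t).$$ (ii) If $\Theta_h\in\,]0,1[$, then for all $t\ge0$: $$\widetilde{a}_2(t+N_hT_{hyp})=\widetilde{a}_2(t)+O\left(\frac{1}{|\ln h|^{2-2\gamma}}\right);$$ in particular $$\left|a_2(t+N_hT_{hyp})\right|=\left|a_2(t)\right|+O\left(\frac{1}{|\ln h|^{2-2\gamma}}\right).$$
   Context: Potential and spectral functions. Let $V\in C^\infty(\mathbb{R})$ be real-valued, bounded below, with $V(x)\to+\infty$ as $|x|\to\infty$, having exactly one local maximum, which is non-degenerate and located at $0$, with $V(0)=V'(0)=0$, $V''(0)<0$; let $P_h=-\frac{h^2}{2}\frac{d^2}{dx^2}+V$, $h>0$ small. The singular Bohr-Sommerfeld theory of Colin de Verdière and Parisse attaches to $P_h$ near energy $0$ real-valued smooth functions $\varepsilon,S^+,S^-$ on an interval $[-\delta,\delta]$ ($\delta>0$ independent of $h$), depending on $h$, with asymptotic expansions as $h\to0^+$ (uniform on $[-\delta,\delta]$ together with all $E$-derivatives) $\varepsilon(E)=\sum_{j\ge0}\varepsilon_j(E)h^j$, $S^{\pm}(E)=\sum_{j\ge0}S_j^{\pm}(E)h^j$, with smooth $h$-independent coefficients, $\varepsilon_0(0)=0$, $\varepsilon_0'(0)=1/\sqrt{-V''(0)}$. Put $\theta_\pm=S^\pm/h$ and, for $\lambda\in[-1,1]$, $f_h(\lambda)=F_h(\lambda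 h)$, $g_h(\lambda)=G_h(\lambda h)$, where $F_h(E)=-\frac{\theta_+(E)+\theta_-(E)}{2}+\frac{\pi}{2}+\frac{\varepsilon(E)}{h}\ln h+\arg\Gamma\left(\frac12+i\frac{\varepsilon(E)}{h}\right)$ (with $\arg\Gamma=\mathrm{Im}\ln\Gamma$ the continuous determination) and $G_h(E)=\frac{\theta_+(E)-\theta_-(E)}{2}$. Let $\mathcal{Y}_h(\lambda)=f_h(\lambda)-\arccos\left(\frac{\cos g_h(\lambda)}{\sqrt{1+\exp(2\pi\varepsilon(\lambda h)/h)}}\right)$, $\lambda\in[-1,1]$. It is known that for $h$ small $\mathcal{Y}_h$ is a bijection of $[-1,1]$ onto its image and $\mathcal{Y}_h'(\lambda)=\frac{\ln h}{\sqrt{-V''(0)}}+O(1)$ uniformly on $[-1,1]$. Let $\mathcal{A}_h=\mathcal{Y}_h^{-1}:\mathcal{Y}_h([-1,1])\to[-1,1]$ (smooth) and $\mathbf{I}_h=\{k\in\mathbb{Z}: 2\pi k\in\mathcal{Y}_h([-1,1])\}$. Initial state. Fix $E\in[-1,1]$ and let $n_0=n_0(h,E)$ be the (assumed unique) minimizer over $n\in\mathbf{I}_h$ of $|h\mathcal{A}_h(2\pi n)-hE|$; one has $n_0\sim N/h$ as $h\to0^+$ for a constant $N>0$. Fix $\chi\in\mathcal{S}(\mathbb{R})$ not identically zero, non-negative and even, and $0\le\gamma'<1$. Put $a_n=K_h\,\chi\left(\frac{n-n_0}{|\ln h|^{1-\gamma'}}\right)$, $n\in\mathbb{Z}$, where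 $K_h>0$ is the normalizing constant $K_h=\left\|\chi\left(\frac{\cdot-n_0}{|\ln h|^{1-\gamma'}}\right)\right\|_{\ell^2(\mathbb{N})}^{-1}$. The real number $\gamma$ satisfies $\gamma<1$ and $\gamma+\gamma'>1$. Periods. $T_{hyp}=1/\mathcal{A}_h'(2\pi n_0)$ and $T_{rev}=\frac{1}{\pi\mathcal{A}_h''(2\pi n_0)}$ (assuming $\mathcal{A}_h''(2\pi n_0)\ne0$). $N_h$ is the integer part (floor) of $T_{rev}/T_{hyp}$ and $\Theta_h\in[0,1[$ is defined by $T_{rev}/T_{hyp}=N_h+\Theta_h$. Second-order approximations of the partial autocorrelation function: $\widetilde{a}_2(t)=\sum_{n\in\mathbb{N}}|a_n|^2e^{-it\left(\mathcal{A}_h'(2\pi n_0)2\pi(n-n_0)+\mathcal{A}_h''(2\pi n_0)2\pi^2(n-n_0)^2\right)}$ and $a_2(t)=e^{-it\mathcal{A}_h(2\pi n_0)}\,\widetilde{a}_2(t)$, for $t\in\mathbb{R}$. Convention: $O(\cdot)$ is as $h\to0^+$, with constants independent of $t$. *)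

(* Defs.v *)
From HB Require Import structures.
From mathcomp Require Import all_boot all_order all_algebra.
From mathcomp Require Import all_classical all_reals all_analysis.
From mathcomp Require Import complex.

Set Implicit Arguments.
Unset Strict Implicit.
Unset Printing Implicit Defensive.

Import Order.TTheory GRing.Theory Num.Theory.
Import numFieldNormedType.Exports.

Local Open Scope classical_set_scope.
Local Open Scope ring_scope.
Local Open Scope complex_scope.

(* Derivatives relative to a set [S]: one-sided at an end point of an interval,
   the usual ones in its interior.  They are needed because [eps], [S+-] live
   on [-delta, delta] and [A_h] lives on a closed interval. *)

Definition diffq {R : realType} (f : R -> R) (x y : R) : R :=
  (f y - f x) / (y - x).

Definition derivable_on {R : realType} (S : set R) (f : R -> R) (x : R) : Prop :=
  cvg (diffq f x y @[y --> within S x^']).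

Definition derive_on {R : realType} (S : set R) (f : R -> R) (x : R) : R :=
  lim (diffq f x y @[y --> within S x^']).

Definition deriven_on {R : realType} (S : set R) (n : nat) (f : R -> R) : R -> R :=
  iter n (derive_on S) f.

Definition smooth_on {R : realType} (S : set R) (f : R -> R) : Prop :=
  forall (n : nat) (x : R), S x -> derivable_on S (deriven_on S n f) x.

Definition smooth {R : realType} (f : R -> R) : Prop :=
  forall (n : nat) (x : R), derivable (derive1n n f) x 1.

Definition schwartz {R : realType} (f : R -> R) : Prop :=
  smooth f /\
  forall k m : nat, exists C : R, forall x : R, `|x ^+ k * derive1n m f x| <= C.

Definition local_max {R : realType} (f : R -> R) (x : R) : Prop :=
  \forall y \near x, f y <= f x.

Record is_potential {R : realType} (V : R -> R) : Prop := IsPotential {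
  potential_smooth : smooth V;
  potential_bounded_below : exists m : R, forall x : R, m <= V x;
  potential_pinfty : V x @[x --> +oo] --> +oo;
  potential_ninfty : V x @[x --> -oo] --> +oo;
  potential_local_max : forall x : R, local_max V x <-> x = 0;
  potential_0 : V 0 = 0;
  potential_d1 : derive1 V 0 = 0;
  potential_d2 : derive1n 2 V 0 < 0 }.

(* [F h E ~ sum_j c j E h^j] as [h -> 0+], uniformly for [E] in [S] and
   together with all derivatives in [E]; the coefficients are smooth. *)
Definition has_expansion {R : realType} (S : set R)
    (F : R -> R -> R) (c : nat -> R -> R) : Prop :=
  (forall j : nat, smooth_on S (c j)) /\
  forall J k : nat, exists C : R, \forall h \near 0^'+, forall E : R, S E ->
    `|deriven_on S k (fun E' => F h E' - \sum_(j < J) c j E' * h ^+ j) E|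
      <= C * h ^+ J.

Definition expi {R : realType} (x : R) : R[i] := cos x +i* sin x.

Definition cseries {R : realType} (u : nat -> R[i]) : R[i] :=
  limn (series (fun n => complex.Re (u n)))
    +i* limn (series (fun n => complex.Im (u n))).

(* Euler's integral of [t^(z-1) e^(-t)] over t > 0, for Re z > 0, where
   [t^(z-1) = t^(Re z - 1) (cos (Im z ln t) + i sin (Im z ln t))]. *)
Definition Gamma {R : realType} (z : R[i]) : R[i] :=
  (\int[@lebesgue_measure R]_(t in `]0%R, +oo[)
     (t `^ (complex.Re z - 1) * expR (- t) * cos (complex.Im z * ln t)))
  +i*
  (\int[@lebesgue_measure R]_(t in `]0%R, +oo[)
     (t `^ (complex.Re z - 1) * expR (- t) * sin (complex.Im z * ln t))).

(* [arg x] is the continuous determination of [arg (Gamma (1/2 + i x))], i.e.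
   [Im (ln Gamma)]: it vanishes at [x = 0], where Gamma is positive. *)
Definition is_arg_Gamma_half {R : realType} (arg : R -> R) : Prop :=
  [/\ continuous arg, arg 0 = 0 &
      forall x : R, Gamma (2^-1 +i* x) = `|Gamma (2^-1 +i* x)| * expi (arg x)].

(* In the next three definitions [h] is fixed, and [eps], [Sp], [Sm] are the
   functions of the energy attached to that value of [h]. *)

Definition calF {R : realType} (arg : R -> R) (h : R) (eps Sp Sm : R -> R)
    (E : R) : R :=
  - ((Sp E / h + Sm E / h) / 2) + pi / 2 + eps E / h * ln h + arg (eps E / h).

Definition calG {R : realType} (h : R) (Sp Sm : R -> R) (E : R) : R :=
  (Sp E / h - Sm E / h) / 2.

Definition calY {R : realType} (arg : R -> R) (h : R) (eps Sp Sm : R -> R)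
    (lambda : R) : R :=
  calF arg h eps Sp Sm (lambda * h) -
  acos (cos (calG h Sp Sm (lambda * h)) /
        Num.sqrt (1 + expR (2 * pi * eps (lambda * h) / h))).

Definition imY {R : realType} (Y : R -> R) : set R := Y @` `[-1, 1].

(* The inverse [imY Y -> [-1, 1]] of [Y] (extended by 0 outside [imY Y]). *)
Definition calA {R : realType} (Y : R -> R) : R -> R :=
  'pinv_(fun=> 0) `[-1, 1] Y.

Definition bfI {R : realType} (Y : R -> R) : set int :=
  [set k | imY Y (2 * pi * k%:~R)].

Definition is_minimizer {R : realType} (Y : R -> R) (h E : R) (n : int) : Prop :=
  let dist k := `|h * calA Y (2 * pi * k%:~R) - h * E| in
  bfI Y n /\ forall k : int, bfI Y k -> dist n <= dist k.

Definition is_unique_minimizer {R : realType} (Y : R -> R) (h E : R) (n : int)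
    : Prop :=
  is_minimizer Y h E n /\ forall k : int, is_minimizer Y h E k -> k = n.

Definition dA {R : realType} (Y : R -> R) (n : int) : R :=
  deriven_on (imY Y) 1 (calA Y) (2 * pi * n%:~R).

Definition d2A {R : realType} (Y : R -> R) (n : int) : R :=
  deriven_on (imY Y) 2 (calA Y) (2 * pi * n%:~R).

Definition Thyp {R : realType} (Y : R -> R) (n0 : int) : R := 1 / dA Y n0.

Definition Trev {R : realType} (Y : R -> R) (n0 : int) : R :=
  1 / (pi * d2A Y n0).

Definition Nh {R : realType} (Y : R -> R) (n0 : int) : int :=
  Num.floor (Trev Y n0 / Thyp Y n0).

Definition Theta {R : realType} (Y : R -> R) (n0 : int) : R :=
  Trev Y n0 / Thyp Y n0 - (Nh Y n0)%:~R.

Definition profile {R : realType} (chi : R -> R) (gamma' h : R) (n0 n : int) : R :=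
  chi ((n - n0)%:~R / `|ln h| `^ (1 - gamma')).

Definition Knorm {R : realType} (chi : R -> R) (gamma' h : R) (n0 : int) : R :=
  (Num.sqrt (limn (series
     (fun n : nat => `|profile chi gamma' h n0 n%:Z| ^+ 2))))^-1.

Definition coeff {R : realType} (chi : R -> R) (gamma' h : R) (n0 n : int) : R :=
  Knorm chi gamma' h n0 * profile chi gamma' h n0 n.

Definition atilde2 {R : realType} (Y : R -> R) (a : int -> R) (n0 : int) (t : R)
    : R[i] :=
  cseries (fun n : nat =>
    let m : R := (n%:Z - n0)%:~R in
    (`|a n%:Z| ^+ 2)%:C *
    expi (- (t * (dA Y n0 * (2 * pi * m) + d2A Y n0 * (2 * pi ^+ 2 * m ^+ 2))))).

Definition a2 {R : realType} (Y : R -> R) (a : int -> R) (n0 : int) (t : R)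
    : R[i] :=
  expi (- (t * calA Y (2 * pi * n0%:~R))) * atilde2 Y a n0 t.

Definition cmod {R : realType} (z : R[i]) : R := complex.Re `|z|.

(* Main.v *)
Require Import Defs.
From mathcomp Require Import all_boot all_order all_algebra.
From mathcomp Require Import all_classical all_reals all_analysis.
From mathcomp Require Import measurable_realfun lebesgue_integral_under.
From mathcomp Require Import complex ring lra.

Set Implicit Arguments.
Unset Strict Implicit.
Unset Printing Implicit Defensive.

Import Order.TTheory GRing.Theory Num.Theory.
Import numFieldNormedType.Exports.
Local Open Scope classical_set_scope.
Local Open Scope ring_scope.

(** Put m = n - n_0 and write A', A'' for the first two derivatives of the
    inverse function A_h at 2 pi n_0, so that the n-th term has the phase
    - t (2 pi A' m + 2 pi^2 A'' m^2), with T_hyp A' = 1 and pi T_rev A'' = 1.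
    A shift of t by N_h T_hyp = T_rev - Theta_h T_hyp changes this phase by an
    integer multiple of 2 pi plus the defect Theta_h 2 pi^2 (A'' / A') m^2. For
    Theta_h = 0 nothing is left, and this is the exact revival. In general the
    series moves by at most a constant times |A'' / A'| times the second moment
    of the coefficients, the sum of |a_n|^2 m^2. Two estimates remain:

    - A'' / A' = O(|ln h|^(-2)) ([calY_derivative_bounds] followed by
      [second_derivative_calA]);
    - the second moment is O(|ln h|^(2 - 2 gamma')) ([coeff_moments]).

    Their product is O(|ln h|^(- 2 gamma')), and 2 gamma' > 2 - 2 gamma.

    For the first one, A'' / A' = - Y'' / Y'^2 for A the inverse of Y, so it is
    enough that Y' <= - c |ln h| and that Y' has a Lipschitz constant independent
    of h. In the rescaled variable lambda = E / h, every differentiation costs a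
    factor h: eps (lambda h) / h and S (lambda h) / h have bounded first
    derivatives and second derivatives of order h. Hence Y is the sum of
    (eps (lambda h) / h) ln h, whose slope is of order ln h and whose second
    derivative is of order h |ln h|, and of a part with bounded derivatives: the
    argument of arccos stays away from 1 and -1 because eps (lambda h) / h is
    bounded, and the argument of Gamma (1/2 + i x) is twice continuously
    differentiable in x. The last point rests on differentiation under Euler's
    integral and on the fact that Gamma has no zero on the line of real part 1/2
    ([gamma_half_neq0]): by the functional equation a zero at 1/2 + i x would
    entail zeros at all n + 1/2 + i x, whereas Gamma (s + i x) is close to
    s^(i x) Gamma (s) for s large.

    For the second one, the profile decays fast enough for its sums over the
    lattice to be compared with integrals: with l = |ln h|^(1 - gamma'), the sum
    of chi(m/l)^2 is at least of order l, and that of m^2 chi(m/l)^2 at most of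
    order l^3. *)

(** * Rules of differentiation *)

Section Calculus.
Context {R : realType}.
Implicit Types (f g : R -> R) (x a b : R).

(** These rules are stated for functions written as terms in a bound variable:
    a proof term that follows the shape of such a function is a proof of its
    differentiability. *)
Lemma derD f g x a b : is_derive x 1 f a -> is_derive x 1 g b ->
  is_derive x 1 (fun y => f y + g y) (a + b).
Proof. by move=> df dg; exact: (is_deriveD df dg). Qed.

Lemma derN f x a : is_derive x 1 f a -> is_derive x 1 (fun y => - f y) (- a).
Proof. by move=> df; exact: (is_deriveN df). Qed.

Lemma derB f g x a b : is_derive x 1 f a -> is_derive x 1 g b ->
  is_derive x 1 (fun y => f y - g y) (a - b).
Proof. by move=> df dg; exact: (is_deriveB df dg). Qed.

Lemma derM f g x a b : is_derive x 1 f a -> is_derive x 1 g b ->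
  is_derive x 1 (fun y => f y * g y) (a * g x + f x * b).
Proof.
by move=> df dg; apply: is_derive_eq (is_deriveM df dg) _; rewrite addrC [a * _]mulrC.
Qed.

Lemma derZ f (k : R) x a : is_derive x 1 f a -> is_derive x 1 (fun y => k * f y) (k * a).
Proof. by move=> df; exact: (is_deriveZ k df). Qed.

Lemma derV f x a : is_derive x 1 f a -> f x != 0 ->
  is_derive x 1 (fun y => (f y)^-1) (- a / f x ^+ 2).
Proof.
move=> df fx; apply: is_derive_eq (is_deriveV fx df) _.
by rewrite [LHS]/GRing.scale/= mulNr mulrC mulNr.
Qed.

Lemma der_cst (k : R) x : is_derive x 1 (fun=> k) 0.
Proof. exact: is_derive_cst. Qed.

Lemma der_id x : is_derive x 1 (fun y : R => y) 1.
Proof. exact: is_derive_id. Qed.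

Lemma der_comp f g x a b : is_derive (g x) 1 f a -> is_derive x 1 g b ->
  is_derive x 1 (fun y => f (g y)) (a * b).
Proof. by move=> df dg; exact: (is_derive1_comp df dg). Qed.

Lemma derX f (n : nat) x a : is_derive x 1 f a ->
  is_derive x 1 (fun y => f y ^+ n) (n%:R * f x ^+ n.-1 * a).
Proof.
move=> df.
have h : (fun y => f y ^+ n) = f ^+ n by apply/funext => y; rewrite exprfctE.
by rewrite h; exact: (is_deriveX n df).
Qed.

Lemma der_expR f x a : is_derive x 1 f a ->
  is_derive x 1 (fun y => expR (f y)) (expR (f x) * a).
Proof. by move=> df; exact: (@der_comp (@expR R) f _ _ _ (is_derive_expR _) df). Qed.

Lemma der_cos f x a : is_derive x 1 f a ->
  is_derive x 1 (fun y => cos (f y)) (- sin (f x) * a).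
Proof. by move=> df; exact: (@der_comp (@cos R) f _ _ _ (is_derive_cos _) df). Qed.

Lemma der_sin f x a : is_derive x 1 f a ->
  is_derive x 1 (fun y => sin (f y)) (cos (f x) * a).
Proof. by move=> df; exact: (@der_comp (@sin R) f _ _ _ (is_derive_sin _) df). Qed.

Lemma is_derive_continuous f x a : is_derive x 1 f a -> {for x, continuous f}.
Proof. by case=> df _; apply: differentiable_continuous; apply/derivable1_diffP. Qed.

Lemma mvt_between f (df : R -> R) a b :
  (forall z, Num.min a b <= z <= Num.max a b -> is_derive z 1 f (df z)) ->
  exists2 z, Num.min a b <= z <= Num.max a b & f b - f a = df z * (b - a).
Proof.
wlog ab : a b / a < b.
  move=> H; have [->|] := eqVneq a b.
    by exists b; rewrite ?minxx ?maxxx ?lexx// !subrr mulr0.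
  rewrite neq_lt => /orP[/H//|ba] hd.
  rewrite minC maxC in hd *; have [z zab E] := H b a ba hd.
  by exists z => //; rewrite -[LHS]opprB E -mulrN opprB.
rewrite (min_l (ltW ab)) (max_r (ltW ab)) => dff.
have dff' z : z \in `]a, b[ -> is_derive z 1 f (df z).
  by rewrite in_itv/= => /andP[az zb]; apply: dff; rewrite !ltW.
have cf : {within `[a, b], continuous f}.
  apply: continuous_in_subspaceT => z; rewrite inE/= in_itv/= => zab.
  exact: is_derive_continuous (dff z zab).
have [c] := MVT ab dff' cf; rewrite in_itv/= => /andP[ac cb] E.
by exists c => //; rewrite !ltW.
Qed.

Lemma mvt_bound f (df : R -> R) a b (M : R) :
  (forall z, Num.min a b <= z <= Num.max a b -> is_derive z 1 f (df z)) ->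
  (forall z, Num.min a b <= z <= Num.max a b -> `|df z| <= M) ->
  `|f b - f a| <= M * `|b - a|.
Proof.
by move=> /mvt_between[z zab ->] dfM; rewrite normrM ler_wpM2r// dfM.
Qed.

Lemma sin_le_norm x : `|sin x| <= `|x|.
Proof.
have := @mvt_bound (@sin R) (@cos R) 0 x 1 (fun z _ => is_derive_sin z).
by rewrite sin0 !subr0 mul1r; apply=> z _; exact: cos_max.
Qed.

Lemma cos_ge1Bsqr x : 1 - x ^+ 2 / 2 <= cos x.
Proof.
have -> : x = (x / 2) *+ 2 by rewrite -mulr_natr divfK.
set y := x / 2.
rewrite cos_mulr2n cos2sin2.
have h : sin y ^+ 2 <= y ^+ 2.
  rewrite -[sin y ^+ 2]real_normK ?num_real// -[y ^+ 2]real_normK ?num_real//.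
  by rewrite ler_sqr ?nnegrE// sin_le_norm.
have -> : (y *+ 2) ^+ 2 = 4 * y ^+ 2 by rewrite -mulr_natr; ring.
by rewrite -[(1 - _) *+ 2]mulr_natr; lra.
Qed.

End Calculus.

(** * Integration over the positive half-line *)

Section HalfLine.
Context {R : realType}.
Notation mu := (@lebesgue_measure R).
Implicit Types (f F : R -> R).

Definition exhaust (n : nat) : set R := `[n.+1%:R^-1, n.+2%:R]%classic.

Lemma exhaust_lt (n : nat) : n.+1%:R^-1 < n.+2%:R :> R.
Proof.
by rewrite (@le_lt_trans _ _ 1) ?ltr1n// invf_le1 ?ler1n ?ltr0n.
Qed.

Lemma exhaust_pos (n : nat) (t : R) : exhaust n t -> 0 < t.
Proof.
by rewrite /exhaust/= in_itv/= => /andP[+ _]; apply: lt_le_trans; rewrite invr_gt0.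
Qed.

Lemma exhaust_near (t : R) : 0 < t -> \forall n \near \oo, exhaust n t.
Proof.
move=> t0; near=> n; rewrite /exhaust/= in_itv/=; apply/andP; split.
  rewrite invf_ple ?posrE//; near: n.
  exists (Num.bound t^-1) => // n /= hn.
  apply: ltW; apply: (lt_le_trans (archi_boundP _)); first by rewrite invr_ge0 ltW.
  by rewrite ler_nat (leq_trans hn).
near: n; exists (Num.bound t) => // n /= hn.
apply: ltW; apply: (lt_le_trans (archi_boundP _)); first by rewrite ltW.
by rewrite ler_nat (leq_trans hn)// ltnW// .
Unshelve. all: by end_near. Qed.

Lemma exhaust_homo (m n : nat) : (m <= n)%N -> exhaust m `<=` exhaust n.
Proof.
move=> mn t; rewrite /exhaust/= !in_itv/= => /andP[h1 h2]; apply/andP; split.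
  by apply: le_trans h1; rewrite lef_pV2 ?posrE ?ltr0n// ler_nat ltnS.
by apply: (le_trans h2); rewrite ler_nat !ltnS.
Qed.

Lemma bigcup_exhaust : \bigcup_n exhaust n = `]0%R, +oo[%classic.
Proof.
apply/seteqP; split=> t /=.
  by move=> [n _ /exhaust_pos]; rewrite in_itv/= andbT.
rewrite in_itv/= andbT => /exhaust_near [n _ h].
by exists n => //; apply: h => /=.
Qed.

Lemma pos_continuous_measurable f :
  (forall t : R, 0 < t -> {for t, continuous f}) ->
  measurable_fun (`]0%R, +oo[%classic : set R) f.
Proof.
move=> cf; apply: open_continuous_measurable_fun => //.
by move=> t; rewrite inE/= in_itv/= andbT; exact: cf.
Qed.

Lemma exhaust_FTC F f (n : nat) :
  (forall t : R, 0 < t -> is_derive t 1 F (f t)) ->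
  (forall t : R, 0 < t -> {for t, continuous f}) ->
  (\int[mu]_(t in exhaust n) (f t)%:E = (F n.+2%:R - F n.+1%:R^-1)%:E)%E.
Proof.
move=> dF cf.
have cF t : 0 < t -> {for t, continuous F}.
  move=> t0; apply: differentiable_continuous; apply/derivable1_diffP.
  by have [] := dF t t0.
have a0 : 0 < n.+1%:R^-1 :> R by rewrite invr_gt0.
rewrite EFinB; apply: continuous_FTC2.
- exact: exhaust_lt.
- apply: continuous_in_subspaceT => t; rewrite inE => /exhaust_pos; exact: cf.
- split.
  + move=> t; rewrite in_itv/= => /andP[h _].
    by have [] := dF t (lt_trans a0 h).
  + by apply: cvg_at_right_filter; exact: cF.
  + by apply: cvg_at_left_filter; apply: cF.
- move=> t; rewrite in_itv/= => /andP[h _].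
  by rewrite derive1E; apply: derive_val; apply: dF (lt_trans a0 h).
Qed.

(** By monotone convergence along the exhaustion: the integral over each
    piece is a difference of two values of the primitive, at most 2 M. *)
Lemma integrable_of_bounded_primitive F f (M : R) :
  (forall t : R, 0 < t -> is_derive t 1 F (f t)) ->
  (forall t : R, 0 < t -> {for t, continuous f}) ->
  (forall t : R, 0 < t -> 0 <= f t) ->
  (forall t : R, 0 < t -> `|F t| <= M) ->
  mu.-integrable `]0%R, +oo[ (EFin \o f).
Proof.
move=> dF cf f0 FM.
have mf := pos_continuous_measurable cf.
apply/integrableP; split; first exact/measurable_EFinP.
rewrite (_ : (\int[mu]_(x in _) _ = \int[mu]_(x in `]0%R, +oo[) (f x)%:E)%E); last first.
  apply: eq_integral => t; rewrite inE/= in_itv/= andbT => t0.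
  by rewrite ger0_norm// f0.
rewrite -bigcup_exhaust.
apply: (@le_lt_trans _ _ (M + M)%:E); last by rewrite ltry.
have := @ge0_nondecreasing_set_cvg_integral _ (measurableTypeR R) R exhaust (EFin \o f) mu.
move=> /(_ _ _ _ _)/cvg_lim <- //.
- apply: lime_le.
    apply: ereal_nondecreasing_is_cvgn.
    apply: ge0_nondecreasing_set_nondecreasing_integral => //.
    + by move=> m n mn; apply/subsetPset; exact: exhaust_homo.
    + by move=> n; exact: measurable_itv.
    + move=> n; apply/measurable_EFinP; apply: (measurable_funS _ _ mf) => //.
      by rewrite -bigcup_exhaust; exact: bigcup_sup.
    + by move=> n t /exhaust_pos t0; rewrite lee_fin f0.
  apply: nearW => n; rewrite (@exhaust_FTC F)// lee_fin.
  have h1 : `|F n.+2%:R| <= M by apply: FM.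
  have h2 : `|F n.+1%:R^-1| <= M by apply: FM; rewrite invr_gt0.
  by move: h1 h2; rewrite !ler_norml; lra.
- by move=> m n mn; apply/subsetPset; exact: exhaust_homo.
- by move=> n; exact: measurable_itv.
- move=> n; apply/measurable_EFinP; apply: (measurable_funS _ _ mf) => //.
  by rewrite -bigcup_exhaust; exact: bigcup_sup.
- by move=> n t /exhaust_pos t0; rewrite lee_fin f0.
Qed.

Lemma integral_exhaust_cvg f : mu.-integrable `]0%R, +oo[ (EFin \o f) ->
  \int[mu]_(t in exhaust n) f t @[n --> \oo] --> \int[mu]_(t in `]0%R, +oo[) f t.
Proof.
move=> intf.
have sub n : exhaust n `<=` `]0%R, +oo[%classic.
  by rewrite -bigcup_exhaust; exact: bigcup_sup.
have mf : measurable_fun (`]0%R, +oo[%classic : set R) f.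
  by apply/measurable_EFinP; exact: measurable_int intf.
apply: fine_cvg; rewrite fineK; last exact: integrable_fin_num.
rewrite (_ : (fun n => _) = (fun n =>
    \int[mu]_(t in (`]0%R, +oo[%classic : set R)) ((f \_ (exhaust n)) t)%:E)%E); last first.
  apply/funext => n; rewrite -[in LHS](setIidr (sub n)) integral_mkcondr.
  by apply: eq_integral => t _; rewrite /= restrict_EFin.
apply: (@dominated_cvg _ _ _ mu _ _ _ _ (fun t => `|f t|%:E)%E) => //.
- move=> n; apply/measurable_EFinP; apply/measurable_restrict => //.
    exact: measurable_itv.
  by apply: (measurable_funS _ _ mf) => //; exact: subIsetl.
- move=> t; rewrite /= in_itv/= andbT => t0; apply: cvg_EFin.
    exact: nearW.
  apply: cvg_near_cst; near=> n => /=.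
  by rewrite patchE mem_set//; near: n; exact: exhaust_near.
- exact: integrable_norm.
- move=> n t _ /=; rewrite lee_fin patchE; case: ifPn => // _.
  by rewrite normr0.
Unshelve. all: by end_near. Qed.

(** Integrability, rather than a constant sign, is what makes the integrals
    over the exhaustion converge; the integrands of the functional equation
    of Gamma oscillate near 0. *)
Lemma pos_half_line_FTC F f (l0 l1 : R) :
  (forall t : R, 0 < t -> is_derive t 1 F (f t)) ->
  (forall t : R, 0 < t -> {for t, continuous f}) ->
  mu.-integrable `]0%R, +oo[ (EFin \o f) ->
  F t @[t --> 0^'+] --> l0 -> F t @[t --> +oo] --> l1 ->
  \int[mu]_(t in `]0%R, +oo[) f t = l1 - l0.
Proof.
move=> dF cf intf F0 F1.
have /cvg_lim <- // := integral_exhaust_cvg intf.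
rewrite (_ : (fun n => _) = (fun n => F n.+2%:R - F n.+1%:R^-1)); last first.
  by apply/funext => n; rewrite /Rintegral (@exhaust_FTC F).
apply/cvg_lim => //; apply: cvgB.
  have := @cvg_comp _ _ _ (fun n : nat => n.+2%:R : R) F \oo +oo _ _ F1; apply.
  apply/cvgryPge => A; near=> n.
  apply: (@le_trans _ _ n%:R); last by rewrite ler_nat -addn2 leq_addr.
  by near: n; exact: nbhs_infty_ger.
move/cvg_at_rightP : F0; apply; split; last exact: cvg_harmonic.
by move=> n; rewrite invr_gt0.
Unshelve. all: by end_near. Qed.

End HalfLine.

(** * Gamma on vertical lines: integrability and derivatives *)

Section GammaIntegrals.
Context {R : realType}.
Notation mu := (@lebesgue_measure R).
Implicit Types (s t x : R) (k : nat).

Lemma gt0_powRE t (p : R) : 0 < t -> t `^ p = expR (p * ln t).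
Proof. by move=> t0; rewrite /powR gt_eqF. Qed.

Lemma expr_le_expR (n : nat) t : 0 <= t -> t ^+ n <= n`!%:R * expR t.
Proof.
move=> t0; case: n => [|n].
  by rewrite expr0 fact0 mul1r -expR0 ler_expR.
rewrite mulrC -ler_pdivrMr ?ltr0n ?fact_gt0//.
by apply: le_trans (expR_ge1Dxn n t0); rewrite lerDr.
Qed.

Lemma powR_expRN_bounded (p : R) : 0 <= p ->
  exists C : R, forall t, 0 < t -> t `^ p * expR (- t) <= C.
Proof.
move=> p0; pose n := Num.bound p.
exists (1 + n`!%:R) => t t0.
have [t1|t1] := leP t 1.
  apply: (@le_trans _ _ 1); last by rewrite lerDl.
  rewrite gt0_powRE// -expRD -expR0 ler_expR.
  have : p * ln t <= 0 by rewrite mulr_ge0_le0// ln_le0.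
  lra.
apply: (@le_trans _ _ (t ^+ n * expR (- t))).
  rewrite ler_wpM2r ?expR_ge0// -powR_mulrn ?(ltW t0)// ler_powR ?(ltW t1)//.
  by apply/ltW/archi_boundP.
rewrite expRN ler_pdivrMr ?expR_gt0//.
apply: le_trans (expr_le_expR n (ltW t0)) _.
by rewrite ler_wpM2r ?expR_ge0// lerDr.
Qed.

(** Every differentiation in x of the integral of t^(s-1) e^(-t) t^(i x)
    brings down a factor i ln t; the exponent k counts these factors. *)
Definition gamma_weight s k t := t `^ (s - 1) * expR (- t) * ln t ^+ k.

(** The derivative of atan (t^(1/4)), which is bounded: of order t^(-3/4) at 0
    and t^(-5/4) at infinity, it dominates all weights with s >= 1/2. *)
Definition gamma_dominator t := (1 + (t `^ 4^-1) ^+ 2)^-1 * (4^-1 * t `^ (4^-1 - 1)).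

Lemma continuous_gamma_weight s k t : 0 < t -> {for t, continuous (gamma_weight s k)}.
Proof.
move=> t0; apply: is_derive_continuous.
exact: (derM (derM (is_derive1_powR (s - 1) t0) (der_expR (derN (der_id t)))) (derX k (is_derive1_ln t0))).
Qed.

Lemma integrable_gamma_dominator : mu.-integrable `]0%R, +oo[ (EFin \o gamma_dominator).
Proof.
have dF (t : R) : 0 < t -> is_derive t 1 (fun t => atan (t `^ 4^-1)) (gamma_dominator t).
  move=> t0; rewrite /gamma_dominator.
  have h := is_derive1_powR 4^-1 t0.
  exact: (@der_comp _ (@atan R) (fun t => t `^ 4^-1) _ _ _ (is_derive1_atan _) h).
apply: (integrable_of_bounded_primitive dF (M := pi)).
- move=> t t0; apply: is_derive_continuous.
  have h : 1 + (t `^ 4^-1) ^+ 2 != 0 by rewrite gt_eqF// ltr_pwDl// sqr_ge0.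
  have h1 := is_derive1_powR 4^-1 t0.
  have h2 := is_derive1_powR (4^-1 - 1) t0.
  exact: (derM (derV (derD (der_cst 1 t) (derX 2 h1)) h) (derZ 4^-1 h2)).
- move=> t t0; rewrite /gamma_dominator mulr_ge0// ?invr_ge0 ?addr_ge0 ?sqr_ge0//.
  by rewrite mulr_ge0// powR_ge0.
- move=> t t0; have := atan_ltpi2 (t `^ 4^-1); have := atan_gtNpi2 (t `^ 4^-1).
  have := pi_gt0 R; rewrite ler_norml; lra.
Qed.

(** As |ln t|^k <= k! 4^k (t^(1/4) + t^(-1/4)), the quotient of the weight by
    the dominator is bounded by a sum of powers t^p times e^(-t); the smallest
    p is s - 1/2, which is why s >= 1/2 is required. *)
Lemma gamma_weight_le_dominator s k : 2^-1 <= s ->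
  exists2 C : R, 0 <= C & forall t, 0 < t ->
    `|gamma_weight s k t| <= C * gamma_dominator t.
Proof.
move=> s2.
have [C1 H1] := @powR_expRN_bounded s ltac:(lra).
have [C2 H2] := @powR_expRN_bounded (s - 2^-1) ltac:(lra).
have [C3 H3] := @powR_expRN_bounded (s + 2^-1) ltac:(lra).
have C10 : 0 <= C1 by apply: le_trans (H1 1 ltr01); rewrite mulr_ge0 ?powR_ge0 ?expR_ge0.
have C20 : 0 <= C2 by apply: le_trans (H2 1 ltr01); rewrite mulr_ge0 ?powR_ge0 ?expR_ge0.
have C30 : 0 <= C3 by apply: le_trans (H3 1 ltr01); rewrite mulr_ge0 ?powR_ge0 ?expR_ge0.
have f0 : 0 <= k`!%:R * 4 ^+ k :> R by rewrite mulr_ge0// exprn_ge0.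
exists (4 * (k`!%:R * 4 ^+ k) * (C1 + C2 + C3 + C1)).
  by apply: mulr_ge0; [apply: mulr_ge0|lra].
move=> t t0; set v := ln t.
have logb : `|v| ^+ k <= k`!%:R * 4 ^+ k * (t `^ 4^-1 + t `^ (- 4^-1)).
  have h : (`|v| / 4) ^+ k <= k`!%:R * expR (`|v| / 4).
    by apply: expr_le_expR; rewrite divr_ge0.
  have h' : `|v| ^+ k <= k`!%:R * 4 ^+ k * expR (`|v| / 4).
    rewrite mulrAC -ler_pdivrMr ?exprn_gt0//.
    by move: h; rewrite expr_div_n.
  apply: (le_trans h'); rewrite ler_wpM2l// !gt0_powRE// -/v.
  have [v0|v0] := leP 0 v.
    by rewrite ger0_norm// [v / 4]mulrC lerDl expR_ge0.
  by rewrite ltr0_norm// [- v / 4]mulrC mulrN -mulNr lerDr expR_ge0.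
rewrite /gamma_weight !normrM (ger0_norm (powR_ge0 _ _)) (ger0_norm (expR_ge0 _)) normrX -/v.
apply: (le_trans (ler_wpM2l _ logb)); first by rewrite mulr_ge0 ?powR_ge0 ?expR_ge0.
rewrite /gamma_dominator.
rewrite [leRHS](_ : _ =
  (k`!%:R * 4 ^+ k) * ((C1 + C2 + C3 + C1) * t `^ (4^-1 - 1)) / (1 + (t `^ 4^-1) ^+ 2)); last first.
  by field; rewrite gt_eqF// ltr_pwDl// sqr_ge0.
rewrite ler_pdivlMr ?ltr_pwDl ?sqr_ge0//.
rewrite -!mulrA [X in X <= _](_ : _ =
  (k`!%:R * 4 ^+ k) * (t `^ (s - 1) * expR (- t) * (t `^ 4^-1 + t `^ (- 4^-1)) * (1 + (t `^ 4^-1) ^+ 2))); last by ring.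
rewrite [leRHS]mulrA ler_wpM2l//.
have e1 : t `^ (s - 1) = t `^ (4^-1 - 1) * t `^ (s - 4^-1).
  by rewrite !gt0_powRE// -expRD; congr expR; field.
have e2 : (t `^ 4^-1) ^+ 2 = t `^ 2^-1.
  by rewrite !gt0_powRE// -expRM_natl; congr expR; field.
rewrite e1 e2.
rewrite [leLHS](_ : _ =
  t `^ (4^-1 - 1) * (t `^ (s - 4^-1) * (t `^ 4^-1 + t `^ (- 4^-1)) * (1 + t `^ 2^-1) * expR (- t))); last by ring.
rewrite [leRHS]mulrC ler_wpM2l ?powR_ge0//.
have -> : t `^ (s - 4^-1) * (t `^ 4^-1 + t `^ (- 4^-1)) * (1 + t `^ 2^-1) * expR (- t) =
  t `^ s * expR (- t) + t `^ (s - 2^-1) * expR (- t) + t `^ (s + 2^-1) * expR (- t) + t `^ s * expR (- t).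
  have -> : t `^ s = t `^ (s - 4^-1) * t `^ 4^-1.
    by rewrite !gt0_powRE// -expRD; congr expR; field.
  have -> : t `^ (s - 2^-1) = t `^ (s - 4^-1) * t `^ (- 4^-1).
    by rewrite !gt0_powRE// -expRD; congr expR; field.
  have -> : t `^ (s + 2^-1) = t `^ (s - 4^-1) * t `^ 4^-1 * t `^ 2^-1.
    by rewrite !gt0_powRE// -!expRD; congr expR; field.
  have {2}-> : t `^ 4^-1 = t `^ (- 4^-1) * t `^ 2^-1.
    by rewrite !gt0_powRE// -!expRD; congr expR; field.
  ring.
by rewrite !lerD// ?H1 ?H2 ?H3.
Qed.

Lemma integrable_gamma_weightM s k (phi : R -> R) : 2^-1 <= s ->
  (forall t, 0 < t -> {for t, continuous phi}) -> (forall t, `|phi t| <= 1) ->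
  mu.-integrable `]0%R, +oo[ (EFin \o (fun t => gamma_weight s k t * phi t)).
Proof.
move=> s2 cphi phi1; have [C C0 HC] := gamma_weight_le_dominator k s2.
have iC : mu.-integrable `]0%R, +oo[ (EFin \o (fun t => C * gamma_dominator t)).
  rewrite (_ : _ \o _ = (fun t => C%:E * (EFin \o gamma_dominator) t)%E); last by apply/funext => t.
  by apply: integrableZl => //; exact: integrable_gamma_dominator.
apply: le_integrable iC => //.
  apply/measurable_EFinP; apply: pos_continuous_measurable => t t0.
  by apply: continuousM; [exact: continuous_gamma_weight|exact: cphi].
move=> t /=; rewrite in_itv/= andbT => t0; rewrite lee_fin normrM.
apply: le_trans (ler_norm _); apply: le_trans (HC t t0).
by rewrite ler_piMr.
Qed.

(** [gamma_cos s 0 x] and [gamma_sin s 0 x] are the real and imaginary parts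
    of Gamma (s + i x). *)
Definition gamma_cos s k x := \int[mu]_(t in `]0%R, +oo[) (gamma_weight s k t * cos (x * ln t)).
Definition gamma_sin s k x := \int[mu]_(t in `]0%R, +oo[) (gamma_weight s k t * sin (x * ln t)).

Lemma continuous_pos_cosln x t : 0 < t -> {for t, continuous (fun t => cos (x * ln t))}.
Proof.
move=> t0; apply: (@continuous_comp _ _ _ (fun t => x * ln t) cos); last exact: continuous_cos.
by apply: continuousM; [exact: cst_continuous|exact: continuous_ln].
Qed.

Lemma continuous_pos_sinln x t : 0 < t -> {for t, continuous (fun t => sin (x * ln t))}.
Proof.
move=> t0; apply: (@continuous_comp _ _ _ (fun t => x * ln t) sin); last exact: continuous_sin.
by apply: continuousM; [exact: cst_continuous|exact: continuous_ln].
Qed.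

Lemma integrable_gamma_cos s k x : 2^-1 <= s ->
  mu.-integrable `]0%R, +oo[ (EFin \o (fun t => gamma_weight s k t * cos (x * ln t))).
Proof.
move=> s2; apply: integrable_gamma_weightM => //.
  by move=> t t0; exact: continuous_pos_cosln.
by move=> t; exact: cos_max.
Qed.

Lemma integrable_gamma_sin s k x : 2^-1 <= s ->
  mu.-integrable `]0%R, +oo[ (EFin \o (fun t => gamma_weight s k t * sin (x * ln t))).
Proof.
move=> s2; apply: integrable_gamma_weightM => //.
  by move=> t t0; exact: continuous_pos_sinln.
by move=> t; exact: sin_max.
Qed.

Lemma is_derive_param (f df : R -> R -> R) (g : R -> R) x :
  (forall x, mu.-integrable `]0%R, +oo[ (EFin \o f x)) ->
  (forall x t, is_derive x 1 (f ^~ t) (df x t)) ->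
  mu.-integrable `]0%R, +oo[ (EFin \o g) -> (forall t, 0 <= g t) ->
  (forall x t, 0 < t -> `|df x t| <= g t) ->
  is_derive x 1 (fun x => \int[mu]_(t in `]0%R, +oo[) f x t)
    (\int[mu]_(t in `]0%R, +oo[) df x t).
Proof.
move=> intf dff intg g0 dfg.
have p1 y t : partial1of2 f y t = df y t by rewrite partial1of2E; apply: derive_val.
have Ix : `]x - 1, x + 1[%classic x by rewrite /= in_itv/=; lra.
have dom (y t : R) : `]x - 1, x + 1[%classic y -> `]0%R, +oo[%classic t -> `|partial1of2 f y t| <= g t.
  by move=> _; rewrite /= in_itv/= andbT p1 => t0; exact: dfg.
have mD : measurable (`]0%R, +oo[%classic : set (measurableTypeR R)) by exact: measurable_itv.
have iF y : `]x - 1, x + 1[%classic y -> mu.-integrable `]0%R, +oo[ (EFin \o f y) by [].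
have dF (y t : R) : `]x - 1, x + 1[%classic y -> `]0%R, +oo[%classic t -> derivable (f ^~ t) y 1.
  by move=> _ _; exact: ex_derive.
split.
  have H := (derivable_under_integral mD Ix iF dF g0 intg dom). exact: H.
rewrite -derive1E (differentiation_under_integral mD Ix iF dF g0 intg dom).
by apply: eq_Rintegral => t _; rewrite p1.
Qed.

Lemma is_derive_gamma_cos s k x : 2^-1 <= s -> is_derive x 1 (gamma_cos s k) (- gamma_sin s k.+1 x).
Proof.
move=> s2.
have dff (y t : R) : is_derive y 1 (fun y : R => gamma_weight s k t * cos (y * ln t))
    (gamma_weight s k.+1 t * - sin (y * ln t)).
  have h := derZ (gamma_weight s k t) (der_cos (derM (der_id y) (der_cst (ln t) y))).
  by apply: is_derive_eq h _; rewrite /gamma_weight exprS; ring.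
have := @is_derive_param _ _ (fun t => `|gamma_weight s k.+1 t * 1|) x _ dff.
move/(_ _ _ _ _) => h; apply: is_derive_eq.
  apply: h.
  - by move=> y; exact: integrable_gamma_cos.
  - apply: integrable_norm => //; apply: integrable_gamma_weightM => // [t t0|t].
      exact: cst_continuous.
    by rewrite normr1.
  - by move=> t; exact: normr_ge0.
  - move=> y t _; rewrite !normrM normrN normr1 ler_wpM2l//.
    exact: sin_max.
rewrite /gamma_sin -[RHS]mulN1r -RintegralZl//; last exact: integrable_gamma_sin.
by apply: eq_Rintegral => t _; ring.
Qed.

Lemma is_derive_gamma_sin s k x : 2^-1 <= s -> is_derive x 1 (gamma_sin s k) (gamma_cos s k.+1 x).
Proof.
move=> s2.
have dff (y t : R) : is_derive y 1 (fun y : R => gamma_weight s k t * sin (y * ln t))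
    (gamma_weight s k.+1 t * cos (y * ln t)).
  have h := derZ (gamma_weight s k t) (der_sin (derM (der_id y) (der_cst (ln t) y))).
  by apply: is_derive_eq h _; rewrite /gamma_weight exprS; ring.
have := @is_derive_param _ _ (fun t => `|gamma_weight s k.+1 t * 1|) x _ dff.
move/(_ _ _ _ _) => h; apply: is_derive_eq.
  apply: h.
  - by move=> y; exact: integrable_gamma_sin.
  - apply: integrable_norm => //; apply: integrable_gamma_weightM => // [t t0|t].
      exact: cst_continuous.
    by rewrite normr1.
  - by move=> t; exact: normr_ge0.
  - move=> y t _; rewrite !normrM normr1 ler_wpM2l//.
    exact: cos_max.
by [].
Qed.

End GammaIntegrals.

(** * Gamma does not vanish on the line of real part 1/2 *)

Section GammaNonvanishing.
Context {R : realType}.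
Notation mu := (@lebesgue_measure R).
Implicit Types (s t x : R) (k : nat).

Lemma gamma_weight0E s t : 0 < t -> gamma_weight s 0 t = t `^ (s - 1) * expR (- t).
Proof. by move=> t0; rewrite /gamma_weight expr0 mulr1. Qed.

Lemma gamma_weightS s t : 0 < t -> gamma_weight (s + 1) 0 t = t * gamma_weight s 0 t.
Proof.
move=> t0; rewrite !gamma_weight0E// mulrA; congr (_ * _).
by rewrite !gt0_powRE// !mulrBl !mulrDl mul1r !expRB !expRD lnK ?posrE//; field; rewrite gt_eqF.
Qed.

Lemma Rintegral_lin (a b c : R) (f g h : R -> R) :
  mu.-integrable `]0%R, +oo[ (EFin \o f) ->
  mu.-integrable `]0%R, +oo[ (EFin \o g) ->
  mu.-integrable `]0%R, +oo[ (EFin \o h) ->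
  \int[mu]_(t in `]0%R, +oo[) (a * f t + b * g t + c * h t) =
  a * \int[mu]_(t in `]0%R, +oo[) f t + b * \int[mu]_(t in `]0%R, +oo[) g t
   + c * \int[mu]_(t in `]0%R, +oo[) h t
  /\ mu.-integrable `]0%R, +oo[ (EFin \o (fun t => a * f t + b * g t + c * h t)).
Proof.
move=> intf intg inth.
have iZ (d : R) (u : R -> R) : mu.-integrable `]0%R, +oo[ (EFin \o u) ->
    mu.-integrable `]0%R, +oo[ (EFin \o (fun t => d * u t)).
  move=> iu.
  rewrite (_ : _ \o _ = (fun t => d%:E * (EFin \o u) t)%E); last by apply/funext => t.
  exact: integrableZl.
have iD (u v : R -> R) : mu.-integrable `]0%R, +oo[ (EFin \o u) ->
    mu.-integrable `]0%R, +oo[ (EFin \o v) ->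
    mu.-integrable `]0%R, +oo[ (EFin \o (fun t => u t + v t)).
  move=> iu iv.
  rewrite (_ : _ \o _ = (EFin \o u) \+ (EFin \o v))%E; last by apply/funext => t.
  exact: integrableD.
have h1 := iZ a f intf; have h2 := iZ b g intg; have h3 := iZ c h inth.
split; last exact: (iD _ _ (iD _ _ h1 h2) h3).
rewrite RintegralD//; last exact: (iD _ _ h1 h2).
by rewrite RintegralD// !RintegralZl.
Qed.

Lemma gamma_boundary s (phi : R -> R) : 2^-1 <= s -> (forall t, `|phi t| <= 1) ->
  (t `^ s * expR (- t) * phi t @[t --> 0^'+] --> (0 : R)) /\
  (t `^ s * expR (- t) * phi t @[t --> +oo] --> (0 : R)).
Proof.
move=> s2 phi1; have s0 : 0 < s by lra.
split.
  apply: norm_cvg0.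
  apply: (@squeeze_cvgr _ _ _ _ (fun=> 0) (fun t : R => t `^ s)); last 2 first.
  - exact: cvg_cst.
  - exact: powR_cvg0.
  near=> t; rewrite normr_ge0/= !normrM ger0_norm ?powR_ge0// ger0_norm ?expR_ge0//.
  rewrite -mulrA ler_piMr ?powR_ge0// mulr_ile1 ?expR_ge0//.
  rewrite -[leRHS]expR0 ler_expR oppr_le0.
  by near: t; exact: nbhs_right_ge.
have [C HC] := @powR_expRN_bounded R (s + 1) ltac:(lra).
apply/cvgrPdist_le => e e0; near=> t.
have t0 : 0 < t by near: t; exact: nbhs_pinfty_gt.
rewrite sub0r normrN !normrM ger0_norm ?powR_ge0// ger0_norm ?expR_ge0//.
apply: (@le_trans _ _ (t `^ s * expR (- t))).
  by rewrite ler_piMr// mulr_ge0 ?powR_ge0 ?expR_ge0.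
apply: (@le_trans _ _ (C / t)).
  rewrite ler_pdivlMr//; apply: le_trans (HC t t0).
  rewrite [leRHS](_ : _ = t `^ s * expR (- t) * t)//.
  by rewrite !gt0_powRE// mulrDl mul1r expRD lnK ?posrE//; ring.
rewrite ler_pdivrMr// mulrC -ler_pdivrMr//.
Unshelve. all: by end_near. Qed.

(** The derivative of t^s e^(-t) phi t integrates to 0, because this function
    vanishes at both ends. For phi = cos (x ln t) and phi = sin (x ln t) the
    outcome is Gamma (s + 1 + i x) = (s + i x) Gamma (s + i x). *)
Lemma gamma_functional_equation s x (phi psi : R -> R) : 2^-1 <= s ->
  (forall t, 0 < t -> is_derive t 1 phi (x * psi t * t^-1)) ->
  (forall t, `|phi t| <= 1) -> (forall t, `|psi t| <= 1) ->
  (forall t, 0 < t -> {for t, continuous psi}) ->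
  \int[mu]_(t in `]0%R, +oo[) (gamma_weight (s + 1) 0 t * phi t) =
  s * \int[mu]_(t in `]0%R, +oo[) (gamma_weight s 0 t * phi t) +
  x * \int[mu]_(t in `]0%R, +oo[) (gamma_weight s 0 t * psi t).
Proof.
move=> s2 dphi phi1 psi1 cpsi.
have cphi t : 0 < t -> {for t, continuous phi}.
  by move=> t0; exact: is_derive_continuous (dphi t t0).
have i1 := integrable_gamma_weightM 0 s2 cphi phi1.
have i2 := integrable_gamma_weightM 0 s2 cpsi psi1.
have i3 := @integrable_gamma_weightM _ (s + 1) 0 _ ltac:(lra) cphi phi1.
have [E iE] := Rintegral_lin s x (-1) i1 i2 i3.
suff : \int[mu]_(t in `]0%R, +oo[) (s * (gamma_weight s 0 t * phi t) + x * (gamma_weight s 0 t * psi t)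
    + -1 * (gamma_weight (s + 1) 0 t * phi t)) = 0 - 0.
  by rewrite E subr0 mulN1r => /subr0_eq ->.
have [b0 b1] := gamma_boundary s2 phi1.
apply: (@pos_half_line_FTC _ (fun t => t `^ s * expR (- t) * phi t)) => //.
  move=> t t0.
  have h := derM (derM (is_derive1_powR s t0) (der_expR (derN (der_id t)))) (dphi t t0).
  apply: is_derive_eq h _; rewrite gamma_weightS// gamma_weight0E//.
  have -> : t `^ s = t * t `^ (s - 1).
    by rewrite mulr_powRB1 ?ltW//; lra.
  by field; rewrite gt_eqF.
move=> t t0; apply: continuousD.
  apply: continuousD.
    apply: continuousM; first exact: cst_continuous.
    by apply: continuousM; [exact: continuous_gamma_weight|exact: cphi].
  apply: continuousM; first exact: cst_continuous.
  by apply: continuousM; [exact: continuous_gamma_weight|exact: cpsi].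
apply: continuousM; first exact: cst_continuous.
by apply: continuousM; [exact: continuous_gamma_weight|exact: cphi].
Qed.

Lemma gamma_cos_rec s x : 2^-1 <= s -> gamma_cos (s + 1) 0 x = s * gamma_cos s 0 x - x * gamma_sin s 0 x.
Proof.
move=> s2.
have -> : - (x * gamma_sin s 0 x) = x * \int[mu]_(t in `]0%R, +oo[) (gamma_weight s 0 t * - sin (x * ln t)).
  rewrite -mulrN; congr (_ * _).
  rewrite -mulN1r /gamma_sin -RintegralZl//; last exact: integrable_gamma_sin.
  by apply: eq_Rintegral => t _; ring.
apply: (@gamma_functional_equation s x (fun t => cos (x * ln t)) (fun t => - sin (x * ln t)) s2).
- move=> t t0; apply: is_derive_eq (der_cos (derZ x (is_derive1_ln t0))) _.
  by ring.
- by move=> t; exact: cos_max.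
- by move=> t; rewrite normrN; exact: sin_max.
- by move=> t t0; apply: continuousN; exact: continuous_pos_sinln.
Qed.

Lemma gamma_sin_rec s x : 2^-1 <= s -> gamma_sin (s + 1) 0 x = s * gamma_sin s 0 x + x * gamma_cos s 0 x.
Proof.
move=> s2.
apply: (@gamma_functional_equation s x (fun t => sin (x * ln t)) (fun t => cos (x * ln t)) s2).
- move=> t t0; apply: is_derive_eq (der_sin (derZ x (is_derive1_ln t0))) _.
  by ring.
- by move=> t; exact: sin_max.
- by move=> t; exact: cos_max.
- by move=> t t0; exact: continuous_pos_cosln.
Qed.

Lemma gamma_cos0_rec s : 2^-1 <= s -> gamma_cos (s + 1) 0 0 = s * gamma_cos s 0 0.
Proof. by move=> /gamma_cos_rec ->; rewrite mul0r subr0. Qed.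

(** With v = ln t - ln s, the right-hand side is (2 (e^(v/2) - e^(-v/2)))^2,
    and e^w - e^(-w) >= w for w >= 0. *)
Lemma ln_sqr_le t s : 0 < t -> 0 < s -> (ln t - ln s) ^+ 2 <= 4 * (t / s - 2 + s / t).
Proof.
move=> t0 s0; pose v := ln t - ln s.
have -> : t / s = expR v by rewrite /v expRB !lnK.
have -> : s / t = expR (- v) by rewrite /v opprB expRB !lnK.
rewrite -/v.
have main : forall w : R, 0 <= w -> w ^+ 2 <= 4 * (expR w - 2 + expR (- w)).
  move=> w w0.
  have -> : 4 * (expR w - 2 + expR (- w)) = (2 * (expR (w / 2) - expR (- (w / 2)))) ^+ 2.
    have -> : expR w = expR (w / 2) ^+ 2 by rewrite -expRM_natl; congr expR; field.
    have -> : expR (- w) = expR (- (w / 2)) ^+ 2 by rewrite -expRM_natl; congr expR; field.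
    have := expRxMexpNx_1 (w / 2).
    set p := expR _; set q := expR _ => pq.
    have -> : (2 * (p - q)) ^+ 2 = 4 * (p ^+ 2 - 2 * (p * q) + q ^+ 2) by ring.
    by rewrite pq; ring.
  have h : w <= 2 * (expR (w / 2) - expR (- (w / 2))).
    have h1 := expR_ge1Dx (w / 2).
    have h2 : expR (- (w / 2)) <= 1 by rewrite -[leRHS]expR0 ler_expR oppr_le0 divr_ge0.
    lra.
  by rewrite ler_sqr ?nnegrE//; apply: le_trans h.
have [v0|v0] := leP 0 v; first exact: main.
have := main (- v); rewrite opprK sqrrN => H.
by apply: le_trans (H _) _; [lra|rewrite ler_wpM2l//; lra].
Qed.

(** By the recurrence it is enough to treat n = 0, where t^(-1/2) >= e^(-t/2)
    makes the integral at least that of e^(-3t/2). *)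
Lemma gamma_cos0_gt0 n : 0 < gamma_cos (2^-1 + n%:R) 0 0 :> R.
Proof.
elim: n => [|n IH]; last first.
  rewrite -[n.+1%:R]natr1 addrA gamma_cos0_rec; first by rewrite mulr_gt0// ltr_pwDl.
  by rewrite lerDl.
rewrite addr0.
pose F := fun t : R => (- (2 / 3)) * expR (- (3 / 2 * t)).
pose f := fun t : R => expR (- (3 / 2 * t)).
have dF (t : R) : 0 < t -> is_derive t 1 F (f t).
  move=> t0; apply: is_derive_eq (derZ (- (2 / 3)) (der_expR (derN (derZ (3/2) (der_id t))))) _.
  by rewrite /f; field.
have cf (t : R) : 0 < t -> {for t, continuous f}.
  by move=> t0; exact: is_derive_continuous (der_expR (derN (derZ (3/2) (der_id t)))).
have intf : mu.-integrable `]0%R, +oo[ (EFin \o f).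
  apply: (integrable_of_bounded_primitive dF (M := 1)) => //.
    by move=> t _; exact: expR_ge0.
  move=> t t0; rewrite normrM normrN (ger0_norm (expR_ge0 _)) ger0_norm//.
  have : expR (- (3 / 2 * t)) <= 1 by rewrite -[leRHS]expR0 ler_expR; lra.
  by have := expR_ge0 (- (3 / 2 * t)); lra.
have E : \int[mu]_(t in `]0%R, +oo[) f t = 0 - (- (2 / 3)).
  apply: (pos_half_line_FTC dF cf intf).
    have F0 : F 0 = - (2 / 3) by rewrite /F mulr0 oppr0 expR0 mulr1.
    rewrite -F0; apply: cvg_at_right_filter.
    exact: is_derive_continuous (derZ (- (2 / 3)) (der_expR (derN (derZ (3/2) (der_id 0))))).
  rewrite -(mulr0 (- (2 / 3))); apply: cvgM; first exact: cvg_cst.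
  rewrite /=.
  apply: (@cvg_comp _ _ _ (fun t : R => 3 / 2 * t) (fun u => expR (- u)) +oo +oo); last exact: cvgr_expR.
  exact: gt0_cvgMry.
have : \int[mu]_(t in `]0%R, +oo[) f t <= gamma_cos 2^-1 0 0.
  apply: le_Rintegral => //; first exact: integrable_gamma_cos.
  move=> t; rewrite /= in_itv/= andbT => t0.
  rewrite mul0r cos0 mulr1 gamma_weight0E// gt0_powRE// -expRD ler_expR.
  have := ln_sublinear t0; lra.
by rewrite E; lra.
Qed.

Lemma cos_ln_lower s t x : 0 < s -> 0 < t ->
  1 - 2 * x ^+ 2 * (t / s - 2 + s / t) <= cos (x * (ln t - ln s)).
Proof.
move=> s0 t0; apply: le_trans (cos_ge1Bsqr _).
rewrite lerD2l lerN2 exprMn.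
have := ln_sqr_le t0 s0; set u := _ ^+ 2; set v := t / s - 2 + s / t => huv.
have : x ^+ 2 * u <= x ^+ 2 * (4 * v) by rewrite ler_wpM2l// sqr_ge0.
lra.
Qed.

(** The right-hand side is the real part of s^(-i x) Gamma (s + i x), that is
    the integral of t^(s-1) e^(-t) cos (x (ln t - ln s)). This weight
    concentrates near t = s, where the cosine is close to 1; the lower bound
    of [cos_ln_lower] is a combination of t, 1 and 1/t, so that it integrates
    to values of Gamma at s + 1, s and s - 1. *)
Lemma gamma_cos_sin_lower s x : 3 / 2 <= s ->
  (1 - 2 * x ^+ 2 / (s - 1)) * gamma_cos s 0 0 <=
  cos (x * ln s) * gamma_cos s 0 x + sin (x * ln s) * gamma_sin s 0 x.
Proof.
move=> s2; have s0 : 0 < s by lra.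
have s1 : 2^-1 <= s by lra.
have sp1 : 2^-1 <= s + 1 by lra.
have sm1 : 2^-1 <= s - 1 by lra.
have s_neq0 : s != 0 by rewrite gt_eqF.
have sm1_neq0 : s - 1 != 0 by rewrite gt_eqF//; lra.
have ic := integrable_gamma_cos 0 x s1. have is_ := integrable_gamma_sin 0 x s1.
have i0 := integrable_gamma_cos 0 0 s1.
have ip := integrable_gamma_cos 0 0 sp1.
have im := integrable_gamma_cos 0 0 sm1.
have [E1 I1] := Rintegral_lin (1 + 4 * x ^+ 2) (- (2 * x ^+ 2 / s)) (- (2 * x ^+ 2 * s)) i0 ip im.
have [E2 I2] := Rintegral_lin (cos (x * ln s)) (sin (x * ln s)) 0 ic is_ i0.
rewrite -/(gamma_cos s 0 0) -/(gamma_cos (s + 1) 0 0) -/(gamma_cos (s - 1) 0 0) in E1.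
rewrite -/(gamma_cos s 0 x) -/(gamma_sin s 0 x) mul0r addr0 in E2.
have recm := gamma_cos0_rec sm1; rewrite subrK in recm.
have -> : (1 - 2 * x ^+ 2 / (s - 1)) * gamma_cos s 0 0 = (1 + 4 * x ^+ 2) * gamma_cos s 0 0
    + - (2 * x ^+ 2 / s) * gamma_cos (s + 1) 0 0 + - (2 * x ^+ 2 * s) * gamma_cos (s - 1) 0 0.
  rewrite (gamma_cos0_rec s1) recm; move: (gamma_cos (s - 1) 0 0) => G.
  by field; rewrite s_neq0 sm1_neq0.
rewrite -E1 -E2; apply: le_Rintegral => // t; rewrite /= in_itv/= andbT => t0.
have t_neq0 : t != 0 by rewrite gt_eqF.
rewrite !mul0r cos0 !mulr1 addr0 (gamma_weightS _ t0).
have -> : gamma_weight (s - 1) 0 t = gamma_weight s 0 t / t.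
  by rewrite -{2}(subrK 1 s) (gamma_weightS _ t0) mulrC mulKf.
have w0 : 0 <= gamma_weight s 0 t by rewrite gamma_weight0E// mulr_ge0 ?powR_ge0 ?expR_ge0.
have low := ler_wpM2l w0 (cos_ln_lower x s0 t0).
rewrite [x * (ln t - _)]mulrBr cosB in low.
rewrite [leLHS](_ : _ = gamma_weight s 0 t * (1 - 2 * x ^+ 2 * (t / s - 2 + s / t))); last first.
  by field; rewrite s_neq0 t_neq0.
by apply: (le_trans low); rewrite le_eqVlt; apply/orP; left; apply/eqP; ring.
Qed.

(** A zero of Gamma at 1/2 + i x would spread by the functional equation to all
    the points n + 1/2 + i x, against the previous lower bound for n large. *)
Lemma gamma_half_neq0 x : gamma_cos 2^-1 0 x ^+ 2 + gamma_sin 2^-1 0 x ^+ 2 != 0.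
Proof.
rewrite paddr_eq0 ?sqr_ge0// !sqrf_eq0; apply/negP => /andP[/eqP c0 /eqP d0].
have z n : gamma_cos (2^-1 + n%:R) 0 x = 0 /\ gamma_sin (2^-1 + n%:R) 0 x = 0.
  elim: n => [|n [IH1 IH2]]; first by rewrite addr0.
  by rewrite -[n.+1%:R]natr1 addrA gamma_cos_rec ?gamma_sin_rec ?lerDl// IH1 IH2 !mulr0 subr0 addr0.
(* [n] is chosen so that 2 x^2 < s - 1 for s = n + 1/2. *)
pose n := (Num.bound (2 * x ^+ 2)).+1.
have x2 : 0 <= 2 * x ^+ 2 by rewrite mulr_ge0// sqr_ge0.
have hn : 2 * x ^+ 2 + 1 < n%:R by rewrite /n -[ltRHS]natr1 ltrD2r archi_boundP.
have := @gamma_cos_sin_lower (2^-1 + n%:R) x ltac:(lra).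
have [-> ->] := z n; rewrite !mulr0 addr0 leNgt => /negP; apply.
apply: mulr_gt0; last exact: gamma_cos0_gt0.
by rewrite subr_gt0 ltr_pdivrMr; lra.
Qed.

End GammaNonvanishing.

(** * The argument of Gamma on the line of real part 1/2 is twice differentiable *)

Section Arg.
Context {R : realType}.
Implicit Types (x y : R) (A c d r : R -> R).

(** A continuous angle is as regular as the curve (c, d) that it describes:
    near x it differs from A x by the arcsine of the normalised cross product
    of the position vectors. *)
Lemma is_derive_polar_angle A c d r x (c1 d1 r1 : R) :
  (forall y, 0 < r y) -> (forall y, c y = r y * cos (A y)) ->
  (forall y, d y = r y * sin (A y)) -> {for x, continuous A} ->
  is_derive x 1 c c1 -> is_derive x 1 d d1 -> is_derive x 1 r r1 ->
  is_derive x 1 A ((c x * d1 - d x * c1) / r x ^+ 2).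
Proof.
move=> r0 cE dE cA dc dd dr.
(* [w y] is the sine of the angle from the point at x to the point at y. *)
pose w y := (c x * d y - d x * c y) / (r x * r y).
have wE y : w y = sin (A y - A x).
  rewrite /w !cE !dE sinB; field.
  by rewrite !gt_eqF.
have wx : w x = 0 by rewrite wE subrr sin0.
have dw : is_derive x 1 w ((c x * d1 - d x * c1) / r x ^+ 2).
  have h := derM (derB (derZ (c x) dd) (derZ (d x) dc))
    (derV (derZ (r x) dr) (lt0r_neq0 (mulr_gt0 (r0 x) (r0 x)))).
  apply: is_derive_eq h _; field.
  by rewrite gt_eqF.
have dasin : is_derive (w x) 1 (@asin R) 1.
  rewrite wx; have h : -1 < (0:R) < 1 by rewrite ltrN10 ltr01.
  by apply: is_derive_eq (is_derive1_asin h) _; rewrite expr0n subr0 sqrtr1 invr1.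
have := derD (der_cst (A x) x) (der_comp dasin dw); rewrite add0r mul1r => h.
apply: near_eq_is_derive h.
have pi20 : 0 < pi / 2 :> R by rewrite divr_gt0// pi_gt0.
move/cvgrPdist_lt : cA => /(_ _ pi20) near_pi.
near=> y; rewrite wE sinK ?subrKC//.
have : `|A x - A y| < pi / 2 by near: y.
by rewrite in_itv/= ltr_norml => /andP[h1 h2]; apply/andP; split; lra.
Unshelve. all: by end_near. Qed.

Lemma Gamma_halfE x : Gamma (complex.Complex 2^-1 x) =
  complex.Complex (gamma_cos 2^-1 0 x) (gamma_sin 2^-1 0 x).
Proof.
rewrite /Gamma /gamma_cos /gamma_sin /=; congr complex.Complex; apply: eq_Rintegral => t _;
  by rewrite /gamma_weight expr0 mulr1.
Qed.

(** The derivative of the argument is the imaginary part of the logarithmic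
    derivative of the curve, a quotient whose denominator does not vanish. *)
Lemma arg_Gamma_C2 (arg : R -> R) : is_arg_Gamma_half arg ->
  exists arg1 arg2 : R -> R,
    [/\ forall x, is_derive x 1 arg (arg1 x), forall x, is_derive x 1 arg1 (arg2 x)
      & continuous arg2].
Proof.
move=> [carg _ argE].
pose c k := @gamma_cos R 2^-1 k; pose d k := @gamma_sin R 2^-1 k.
pose q y := c 0%N y ^+ 2 + d 0%N y ^+ 2.
pose r y := Num.sqrt (q y).
have q0 y : 0 < q y.
  by rewrite lt0r gamma_half_neq0 addr_ge0 ?sqr_ge0.
have r0 y : 0 < r y by rewrite sqrtr_gt0.
have dc k y : is_derive y 1 (c k) (- d k.+1 y) by exact: is_derive_gamma_cos.
have dd k y : is_derive y 1 (d k) (c k.+1 y) by exact: is_derive_gamma_sin.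
have dq y : is_derive y 1 q (2 * (d 0%N y * c 1%N y - c 0%N y * d 1%N y)).
  apply: is_derive_eq (derD (derX 2 (dc 0%N y)) (derX 2 (dd 0%N y))) _.
  by rewrite /= !expr1; ring.
have dr y : is_derive y 1 r _ := der_comp (is_derive1_sqrt (q0 y)) (dq y).
have polar y : c 0%N y = r y * cos (arg y) /\ d 0%N y = r y * sin (arg y).
  have := argE y; rewrite Gamma_halfE normc_def/= => -[E1 E2]; move: E1 E2.
  by rewrite !mul0r subr0 addr0 -/(c 0%N y) -/(d 0%N y).
pose a1 y := (c 0%N y * c 1%N y + d 0%N y * d 1%N y) / q y.
have darg y : is_derive y 1 arg (a1 y).
  have := is_derive_polar_angle r0 (fun y => (polar y).1) (fun y => (polar y).2)
    (carg y) (dc _ y) (dd _ y) (dr y).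
  by move=> h; apply: is_derive_eq h _; rewrite /a1 sqr_sqrtr ?ltW// mulrN opprK.
pose n1 y := - d 1%N y * c 1%N y - c 0%N y * d 2%N y + c 1%N y * d 1%N y + d 0%N y * c 2%N y.
have dn y : is_derive y 1 (fun y => c 0%N y * c 1%N y + d 0%N y * d 1%N y) (n1 y).
  apply: is_derive_eq (derD (derM (dc 0%N y) (dc 1%N y)) (derM (dd 0%N y) (dd 1%N y))) _.
  by rewrite /n1; ring.
have da1 y : is_derive y 1 a1 _ := derM (dn y) (derV (dq y) (lt0r_neq0 (q0 y))).
exists a1; eexists; split; [exact: darg|exact: da1|].
move=> y.
have n2 := derD (derB (derM (derN (dd 1%N y)) (dc 1%N y)) (derM (dc 0%N y) (dd 2%N y)))
  (derM (dc 1%N y) (dd 1%N y)).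
have n3 := derD n2 (derM (dd 0%N y) (dc 2%N y)).
have q2 := derZ 2 (derB (derM (dd 0%N y) (dc 1%N y)) (derM (dc 0%N y) (dd 1%N y))).
have iq := derV (dq y) (lt0r_neq0 (q0 y)).
have iq2 := derV (derX 2 (dq y)) (lt0r_neq0 (exprn_gt0 2 (q0 y))).
exact: is_derive_continuous (derD (derM n3 iq) (derM (dn y) (derM (derN q2) iq2))).
Qed.

End Arg.

(** * Functions with uniformly bounded first and second derivatives *)

Section TwiceDerivable.
Context {R : realType}.
Implicit Types (f g : R -> R) (M B : R).

(** There is no bound on f itself because the phases S/h are of order 1/h.
    The interval ]-2, 2[ is a neighbourhood of [-1, 1], so that derivatives at
    the end points of [-1, 1] are two-sided. *)
Definition C2_bounded M f := exists f1 f2 : R -> R, forall x : R, `|x| < 2 ->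
  [/\ is_derive x 1 f (f1 x), is_derive x 1 f1 (f2 x), `|f1 x| <= M & `|f2 x| <= M].

Lemma C2_bounded_ge0 M f : C2_bounded M f -> 0 <= M.
Proof.
move=> [f1 [f2 /(_ 0)]]; rewrite normr0 => /(_ (ltr0n _ 2))[_ _ h _].
by apply: le_trans h.
Qed.

Lemma C2_bounded_cst (k : R) : C2_bounded 0 (fun=> k).
Proof.
exists (fun=> 0), (fun=> 0) => x _.
by split; [exact: der_cst|exact: der_cst|rewrite normr0|rewrite normr0].
Qed.

Lemma C2_boundedD M B f g : C2_bounded M f -> C2_bounded B g -> C2_bounded (M + B) (fun x => f x + g x).
Proof.
move=> [f1 [f2 hf]] [g1 [g2 hg]].
exists (fun x => f1 x + g1 x), (fun x => f2 x + g2 x) => x x2.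
have [a1 a2 a3 a4] := hf x x2; have [b1 b2 b3 b4] := hg x x2.
split; [exact: derD|exact: derD| |];
  by apply: (le_trans (ler_normD _ _)); rewrite lerD.
Qed.

Lemma C2_boundedZ M f (k : R) : C2_bounded M f -> C2_bounded (`|k| * M) (fun x => k * f x).
Proof.
move=> [f1 [f2 hf]]; exists (fun x => k * f1 x), (fun x => k * f2 x) => x x2.
have [a1 a2 a3 a4] := hf x x2.
by split; [exact: derZ|exact: derZ| |]; rewrite normrM ler_wpM2l.
Qed.

Lemma C2_boundedM M f g : 1 <= M -> (forall x : R, `|x| < 2 -> `|f x| <= M) ->
  (forall x : R, `|x| < 2 -> `|g x| <= M) ->
  C2_bounded M f -> C2_bounded M g -> C2_bounded (4 * M ^+ 2) (fun x => f x * g x).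
Proof.
move=> M1 fM gM [f1 [f2 hf]] [g1 [g2 hg]].
exists (fun x => f1 x * g x + f x * g1 x).
exists (fun x => (f2 x * g x + f1 x * g1 x) + (f1 x * g1 x + f x * g2 x)) => x x2.
have [a1 a2 a3 a4] := hf x x2; have [b1 b2 b3 b4] := hg x x2.
have MM (u v : R) : `|u| <= M -> `|v| <= M -> `|u * v| <= M ^+ 2.
  by move=> uM vM; rewrite normrM expr2 ler_pM.
split; first exact: derM.
- by apply: derD; exact: derM.
- apply: (le_trans (ler_normD _ _)).
  have h1 := MM _ _ a3 (gM x x2); have h2 := MM _ _ (fM x x2) b3.
  have : 0 <= M ^+ 2 by exact: sqr_ge0.
  lra.
- apply: (le_trans (ler_normD _ _)).
  have h1 := ler_normD (f2 x * g x) (f1 x * g1 x).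
  have h2 := ler_normD (f1 x * g1 x) (f x * g2 x).
  have h3 := MM _ _ a4 (gM x x2); have h4 := MM _ _ a3 b3.
  have h5 := MM _ _ (fM x x2) b4.
  lra.
Qed.

(** Only the values of f matter for phi, hence the set P: it is a compact
    interval for arg Gamma and arccos, and a half-line for y^(-1/2). *)
Lemma C2_bounded_comp (P : R -> Prop) M B f (phi phi1 phi2 : R -> R) :
  (forall x : R, `|x| < 2 -> P (f x)) ->
  (forall y : R, P y -> [/\ is_derive y 1 phi (phi1 y), is_derive y 1 phi1 (phi2 y),
     `|phi1 y| <= B & `|phi2 y| <= B]) ->
  C2_bounded M f -> C2_bounded (B * M ^+ 2 + B * M) (fun x => phi (f x)).
Proof.
move=> Pf hphi hf'; have M0 := C2_bounded_ge0 hf'; move: hf' => [f1 [f2 hf]].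
exists (fun x => phi1 (f x) * f1 x).
exists (fun x => (phi2 (f x) * f1 x) * f1 x + phi1 (f x) * f2 x) => x x2.
have [a1 a2 a3 a4] := hf x x2; have [b1 b2 b3 b4] := hphi _ (Pf x x2).
have B0 : 0 <= B by apply: le_trans b3.
split.
- exact: der_comp.
- exact: (derM (der_comp b2 a1) a2).
- rewrite normrM; apply: (@le_trans _ _ (B * M)); first by rewrite ler_pM.
  by rewrite lerDr mulr_ge0// sqr_ge0.
- apply: (le_trans (ler_normD _ _)); rewrite !normrM; apply: lerD; last by rewrite ler_pM.
  by rewrite expr2 mulrA !ler_pM// mulr_ge0.
Qed.

Lemma continuous_bounded_on (f : R -> R) M : continuous f ->
  exists B, forall y : R, `|y| <= M -> `|f y| <= B.
Proof.
move=> cf; have [M0|M0] := leP 0 M; last first.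
  by exists 0 => y yM; have := le_lt_trans yM M0; rewrite ltNge normr_ge0.
have [||c _ hc] := @EVT_max R (fun y => `|f y|) (- M) M.
- by rewrite lerNl; lra.
- apply: continuous_subspaceT => y.
  by apply: (@continuous_comp _ _ _ f (fun z => `|z|)); [exact: cf|exact: norm_continuous].
by exists `|f c| => y; rewrite ler_norml => yM; apply: hc; rewrite in_itv.
Qed.

Lemma C2_bounded_cos M f : C2_bounded M f -> C2_bounded (1 * M ^+ 2 + 1 * M) (fun x => cos (f x)).
Proof.
apply: (@C2_bounded_comp (fun _ => True) M 1 f (@cos R) (fun y => - sin y) (fun y => - cos y)) => // y _.
split; first exact: is_derive_cos.
- exact: (derN (is_derive_sin y)).
- by rewrite normrN sin_max.
- by rewrite normrN cos_max.
Qed.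

Lemma C2_bounded_inv_sqrt M f : (forall x : R, `|x| < 2 -> 1 <= f x) ->
  C2_bounded M f -> C2_bounded (1 * M ^+ 2 + 1 * M) (fun x => (Num.sqrt (f x))^-1).
Proof.
move=> f1.
apply: (@C2_bounded_comp (fun y => 1 <= y) M 1 f (fun y => (Num.sqrt y)^-1)
  (fun y => - (2 * Num.sqrt y ^+ 3)^-1) (fun y => 3 / (4 * Num.sqrt y ^+ 5))) => // y y1.
have y0 : 0 < y by lra.
have s1 : 1 <= Num.sqrt y by rewrite -sqrtr1 ler_sqrt// ltW.
have s0 : Num.sqrt y != 0 by rewrite gt_eqF//; lra.
have ds := is_derive1_sqrt y0.
split.
- by apply: is_derive_eq (derV ds s0) _; field.
- have s3 : 2 * Num.sqrt y ^+ 3 != 0 by rewrite mulf_neq0 ?expf_neq0.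
  by apply: is_derive_eq (derN (derV (derZ 2 (derX 3 ds)) s3)) _; field.
- have s3 : 1 <= Num.sqrt y ^+ 3 by rewrite exprn_ege1.
  rewrite normrN ger0_norm ?invr_ge0 ?mulr_ge0 ?exprn_ge0//.
  by rewrite invf_le1; lra.
- have s5 : 1 <= Num.sqrt y ^+ 5 by rewrite exprn_ege1.
  rewrite ger0_norm ?divr_ge0 ?mulr_ge0 ?exprn_ge0//.
  by rewrite ler_pdivrMr; lra.
Qed.

Lemma C2_bounded_acos (M rho : R) f : 0 <= rho < 1 -> (forall x : R, `|x| < 2 -> `|f x| <= rho) ->
  C2_bounded M f -> let B := (Num.sqrt (1 - rho ^+ 2))^-1 + (Num.sqrt (1 - rho ^+ 2))^-1 ^+ 3 in
  C2_bounded (B * M ^+ 2 + B * M) (fun x => acos (f x)).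
Proof.
move=> /andP[r0 r1] fr hf B.
apply: (@C2_bounded_comp (fun y => `|y| <= rho) M B f (@acos R)
  (fun y => - (Num.sqrt (1 - y ^+ 2))^-1) (fun y => - y * (Num.sqrt (1 - y ^+ 2))^-1 ^+ 3)) => // y yr.
have y1 : -1 < y < 1 by rewrite -ltr_norml (le_lt_trans yr).
have yrho : y ^+ 2 <= rho ^+ 2 by rewrite -real_normK ?num_real// ler_sqr ?nnegrE.
have rho1 : rho ^+ 2 < 1 by rewrite expr_lt1.
set s := Num.sqrt (1 - y ^+ 2).
have s0 : 0 < s by rewrite sqrtr_gt0; lra.
have sr : Num.sqrt (1 - rho ^+ 2) <= s by rewrite ler_sqrt; lra.
have sr0 : 0 < Num.sqrt (1 - rho ^+ 2) by rewrite sqrtr_gt0; lra.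
have is_ : s^-1 <= (Num.sqrt (1 - rho ^+ 2))^-1 by rewrite lef_pV2 ?posrE.
have is0 : 0 <= s^-1 by rewrite invr_ge0 ltW.
have is3 : s^-1 ^+ 3 <= (Num.sqrt (1 - rho ^+ 2))^-1 ^+ 3 by rewrite lerXn2r ?nnegrE// (le_trans is0).
have i3 : 0 <= (Num.sqrt (1 - rho ^+ 2))^-1 ^+ 3 by rewrite exprn_ge0// (le_trans is0).
split.
- exact: is_derive1_acos.
- have h : 0 < 1 - y ^+ 2 by lra.
  have d := @der_comp _ Num.sqrt (fun z => 1 - z ^+ 2) _ _ _
    (is_derive1_sqrt h) (derB (der_cst 1 y) (derX 2 (der_id y))).
  apply: is_derive_eq (derN (derV d (lt0r_neq0 s0))) _.
  by rewrite -/s expr1; field; rewrite gt_eqF.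
- by rewrite normrN ger0_norm// /B; lra.
- rewrite normrM normrN (ger0_norm (exprn_ge0 3 is0)) /B.
  have : `|y| * s^-1 ^+ 3 <= 1 * s^-1 ^+ 3 by rewrite ler_wpM2r ?exprn_ge0//; lra.
  lra.
Qed.

Lemma C2_bounded_1Dexp M f : 0 <= M -> (forall x : R, `|x| < 2 -> `|f x| <= M) -> C2_bounded M f ->
  let B := (1 + 2 * pi) ^+ 2 * expR (2 * pi * M) in
  C2_bounded (B * M ^+ 2 + B * M) (fun x => 1 + expR (2 * pi * f x)).
Proof.
move=> M0 fM hf B; have p0 := pi_gt0 R.
apply: (@C2_bounded_comp (fun y => `|y| <= M) M B f (fun y => 1 + expR (2 * pi * y))
  (fun y => 2 * pi * expR (2 * pi * y)) (fun y => (2 * pi) ^+ 2 * expR (2 * pi * y))) => // y yM.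
have d := der_expR (derZ (2 * pi) (der_id y)).
have e : expR (2 * pi * y) <= expR (2 * pi * M).
  by rewrite ler_expR ler_wpM2l//; [lra|exact: le_trans (ler_norm _) yM].
have e0 := expR_ge0 (2 * pi * y).
split.
- by apply: is_derive_eq (derD (der_cst 1 y) d) _; rewrite /=; ring.
- by apply: is_derive_eq (derZ (2 * pi) d) _; rewrite /=; ring.
- rewrite ger0_norm; last by rewrite mulr_ge0//; lra.
  by rewrite /B ler_pM//; nra.
- rewrite ger0_norm; last by rewrite mulr_ge0// sqr_ge0.
  by rewrite /B ler_pM ?sqr_ge0//; nra.
Qed.

End TwiceDerivable.

(** * Regular and singular parts of the spectral function *)

Section Splitting.
Context {R : realType}.

Lemma C2_bounded_weaken (A B : R) f : A <= B -> C2_bounded A f -> C2_bounded B f.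
Proof.
move=> AB [f1 [f2 hf]]; exists f1, f2 => x x2; have [? ? ? ?] := hf x x2.
by split => //; exact: le_trans AB.
Qed.

(** Since X is bounded, exp (2 pi X) is bounded below by a positive constant
    and the argument of arccos stays in a compact subset of ]-1, 1[. *)
Lemma C2_bounded_acos_term (M : R) : 1 <= M -> exists K : R, forall X G : R -> R,
  C2_bounded M X -> (forall l : R, `|l| < 2 -> `|X l| <= M) -> C2_bounded M G ->
  C2_bounded K (fun l => acos (cos (G l) * (Num.sqrt (1 + expR (2 * pi * X l)))^-1)).
Proof.
move=> M1; have M0 : 0 <= M by lra.
pose r := Num.sqrt (1 + expR (2 * pi * - M)).
have e0 : 0 < expR (2 * pi * - M) by exact: expR_gt0.
have r1 : 1 < r by rewrite -[ltLHS]sqrtr1 ltr_sqrt; lra.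
have p0 := pi_gt0 R.
have re (x : R) : `|x| <= M -> 0 <= (Num.sqrt (1 + expR (2 * pi * x)))^-1 <= r^-1.
  move=> xM; have := expR_gt0 (2 * pi * x) => ex.
  rewrite invr_ge0 sqrtr_ge0/= lef_pV2 ?posrE; last 2 first.
  - by rewrite sqrtr_gt0; lra.
  - lra.
  rewrite ler_wsqrtr// lerD2l ler_expR ler_wpM2l//; first lra.
  by move: xM; rewrite ler_norml => /andP[].
have r1' : r^-1 < 1 by rewrite invf_lt1; lra.
have r0' : 0 <= r^-1 by rewrite invr_ge0; lra.
clearbody r.
have [T2 hT2] : exists T, forall X, C2_bounded M X -> (forall l : R, `|l| < 2 -> `|X l| <= M) ->
    C2_bounded T (fun l => (Num.sqrt (1 + expR (2 * pi * X l)))^-1).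
  eexists => X X2b Xb; apply: C2_bounded_inv_sqrt (C2_bounded_1Dexp M0 Xb X2b).
  by move=> l _; rewrite lerDl expR_ge0.
pose T1 := 1 * M ^+ 2 + 1 * M.
have [T hT] : exists2 T, 1 <= T & T1 <= T /\ T2 <= T.
  exists (1 + `|T1| + `|T2|).
    by have := normr_ge0 T1; have := normr_ge0 T2; lra.
  by have := ler_norm T1; have := ler_norm T2; have := normr_ge0 T1; have := normr_ge0 T2; lra.
move=> [T1T T2T].
eexists => X G X2b Xb dG.
have dcosG := C2_bounded_weaken T1T (C2_bounded_cos dG).
have dis := C2_bounded_weaken T2T (hT2 X X2b Xb).
have cb (l : R) : `|l| < 2 -> `|cos (G l)| <= T by move=> _; exact: le_trans (cos_max _) hT.
have sb (l : R) : `|l| < 2 -> `|(Num.sqrt (1 + expR (2 * pi * X l)))^-1| <= T.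
  by move=> l2; have /andP[a b] := re _ (Xb l l2); rewrite ger0_norm//; lra.
have du := C2_boundedM hT cb sb dcosG dis.
have rr : 0 <= r^-1 < 1 by apply/andP.
have ub (l : R) : `|l| < 2 ->
    `|cos (G l) * (Num.sqrt (1 + expR (2 * pi * X l)))^-1| <= r^-1.
  move=> l2; have /andP[a b] := re _ (Xb l l2); rewrite normrM (ger0_norm a).
  by rewrite -[leRHS]mul1r ler_pM// cos_max.
exact: (C2_bounded_acos rr ub du).
Qed.

Lemma C2_bounded_arg (arg : R -> R) (M : R) : is_arg_Gamma_half arg ->
  exists K : R, forall X : R -> R, C2_bounded M X ->
    (forall l : R, `|l| < 2 -> `|X l| <= M) -> C2_bounded K (fun l => arg (X l)).
Proof.
move=> harg; have [arg1 [arg2 [d1 d2 c2]]] := arg_Gamma_C2 harg.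
have c1 : continuous arg1 by move=> y; exact: is_derive_continuous (d2 y).
have [B1 hB1] := continuous_bounded_on M c1.
have [B2 hB2] := continuous_bounded_on M c2.
eexists => X X2b Xb.
apply: (@C2_bounded_comp R (fun y => `|y| <= M) M (B1 + B2) X arg arg1 arg2) => // y yM.
have b1 := hB1 y yM; have b2 := hB2 y yM.
have := normr_ge0 (arg1 y); have := normr_ge0 (arg2 y).
by split => //; lra.
Qed.

(** The term eps/h ln h is the only one in Y whose slope grows as h tends
    to 0. *)
Lemma calY_split (arg : R -> R) (M : R) : is_arg_Gamma_half arg -> 1 <= M ->
  exists K : R, forall (h : R) (eps Sp Sm : R -> R),
    C2_bounded M (fun l => eps (l * h) / h) ->
    (forall l : R, `|l| < 2 -> `|eps (l * h) / h| <= M) ->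
    C2_bounded M (fun l => Sp (l * h) / h) -> C2_bounded M (fun l => Sm (l * h) / h) ->
    C2_bounded K (fun l => calY arg h eps Sp Sm l - eps (l * h) / h * ln h).
Proof.
move=> harg M1.
have [Ka hKa] := C2_bounded_arg M harg.
have [Kc hKc] := C2_bounded_acos_term M1.
eexists => h eps Sp Sm X2b Xb dP dQ.
rewrite (_ : (fun l => calY _ _ _ _ _ l - _) = (fun l =>
    - 2^-1 * (Sp (l * h) / h + Sm (l * h) / h) + pi / 2 + arg (eps (l * h) / h) +
    -1 * acos (cos (2^-1 * (Sp (l * h) / h + -1 * (Sm (l * h) / h))) *
      (Num.sqrt (1 + expR (2 * pi * (eps (l * h) / h))))^-1))); last first.
  apply/funext => l; rewrite /calY /calF /calG.
  rewrite (_ : (Sp (l * h) / h - Sm (l * h) / h) / 2 =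
    2^-1 * (Sp (l * h) / h + -1 * (Sm (l * h) / h))); last by ring.
  by rewrite (_ : 2 * pi * eps (l * h) / h = 2 * pi * (eps (l * h) / h)) ?mulrA//; ring.
have dG : C2_bounded M (fun l => 2^-1 * (Sp (l * h) / h + -1 * (Sm (l * h) / h))).
  apply: C2_bounded_weaken (C2_boundedZ 2^-1 (C2_boundedD dP (C2_boundedZ (-1) dQ))).
  by rewrite normrN normr1 ger0_norm//; lra.
exact: (C2_boundedD (C2_boundedD (C2_boundedD (C2_boundedZ (- 2^-1) (C2_boundedD dP dQ))
  (C2_bounded_cst (pi / 2))) (hKa _ X2b Xb))
  (C2_boundedZ (-1) (hKc _ _ X2b Xb dG))).
Qed.

End Splitting.

(** * One-sided and two-sided derivatives *)

Section DerivOn.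
Context {R : realType}.
Implicit Types (f g : R -> R) (x l delta : R) (S : set R).

Lemma within_dnbhs_interior S x : nbhs x S -> within S x^' = x^'.
Proof.
move=> Sx; apply/seteqP; split=> P; rewrite /within/= => h.
- move: h; rewrite /dnbhs /within/=; apply: filterS2 Sx => y Sy h yx.
  exact: h.
- by apply: filterS h => y Py _.
Qed.

(** Caratheodory's formulation: the difference quotient, completed by the
    derivative at x, is continuous at x. *)
Lemma is_derive_diffq f x (a : R) :
  diffq f x y @[y --> x^'] --> a <-> is_derive x 1 f a.
Proof.
split=> [h|/is_derive1_caratheodory [g [gE cg ga]]].
- apply/is_derive1_caratheodory.
  exists (fun z => if z == x then a else diffq f x z); split.
  + move=> z; case: eqP => [->|/eqP zx]; first by rewrite !subrr mulr0.
    by rewrite /diffq divfK// subr_eq0.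
  + apply/continuous_withinNx; rewrite eqxx; apply: cvg_trans h.
    apply: near_eq_cvg; near=> y; rewrite ifN//.
    by near: y; exact: nbhs_dnbhs_neq.
  + by rewrite eqxx.
- move/continuous_withinNx : cg; rewrite ga; apply: cvg_trans.
  apply: near_eq_cvg; near=> y; rewrite /diffq gE mulfK// subr_eq0.
  by near: y; exact: nbhs_dnbhs_neq.
Unshelve. all: by end_near. Qed.

Lemma derive_on_interior S f x : nbhs x S -> derivable_on S f x ->
  is_derive x 1 f (derive_on S f x).
Proof.
by move=> Sx h; apply/is_derive_diffq; move: h; rewrite /derivable_on /derive_on within_dnbhs_interior.
Qed.

Lemma derive_onE S f x (a : R) : nbhs x S -> is_derive x 1 f a -> derive_on S f x = a.
Proof.
move=> Sx /is_derive_diffq h; rewrite /derive_on within_dnbhs_interior//.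
exact: cvg_lim h.
Qed.

Lemma smooth_on_is_derive S f n x : nbhs x S -> smooth_on S f ->
  is_derive x 1 (deriven_on S n f) (deriven_on S n.+1 f x).
Proof.
move=> Sx sf; apply: derive_on_interior => //; apply: sf.
exact: nbhs_singleton.
Qed.

Lemma nbhs_segment x delta : `|x| < delta -> nbhs x [set` `[- delta, delta]].
Proof.
move=> xd; have : x \in `]- delta, delta[ by rewrite in_itv/= -ltr_norml.
move/near_in_itvoo; apply: filterS => y; rewrite /= !in_itv/= => /andP[? ?].
by rewrite !ltW.
Qed.

End DerivOn.

(** * Slope and Lipschitz constant of the spectral function *)

Section Expansion.
Context {R : realType}.
Implicit Types (delta h : R) (F : R -> R -> R) (c : nat -> R -> R).

Lemma has_expansion_deriv_bounded S F c k : has_expansion S F c ->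
  exists C : R, \forall h \near 0^'+, forall E, S E -> `|deriven_on S k (F h) E| <= C.
Proof.
move=> [_ /(_ 0%N k)[C hC]]; exists C; apply: filterS hC => h hC E SE.
have := hC E SE; rewrite expr0 mulr1.
by rewrite (_ : (fun E' => _) = F h)//; apply/funext => E'; rewrite big_ord0 subr0.
Qed.

Lemma has_expansion_leading S F c k : has_expansion S F c ->
  exists C : R, \forall h \near 0^'+, forall E, S E ->
    `|deriven_on S k (fun E' => F h E' - c 0%N E') E| <= C * h.
Proof.
move=> [_ /(_ 1%N k)[C hC]]; exists C; apply: filterS hC => h hC E SE.
have := hC E SE; rewrite expr1; congr (`|deriven_on S k _ E| <= _).
by apply/funext => E'; rewrite big_ord1 expr0 mulr1.
Qed.

Lemma scaled_derivatives (delta h : R) (f : R -> R) : 0 < h -> h * 2 < delta ->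
  smooth_on [set` `[- delta, delta]] f ->
  let J := [set` `[- delta, delta]] in
  forall l : R, `|l| < 2 ->
    [/\ J (l * h), is_derive l 1 (fun l => f (l * h) / h) (deriven_on J 1 f (l * h)) &
     is_derive l 1 (fun l => deriven_on J 1 f (l * h)) (h * deriven_on J 2 f (l * h))].
Proof.
move=> h0 hd sf J l l2.
have lh : `|l * h| < delta.
  rewrite normrM (gtr0_norm h0); apply: lt_trans hd.
  by rewrite mulrC ltr_pM2l.
have nJ := nbhs_segment lh.
have d0 := smooth_on_is_derive 0 nJ sf.
have d1 := smooth_on_is_derive 1 nJ sf.
have dl : is_derive l 1 (fun l => l * h) h.
  by apply: is_derive_eq (derM (der_id l) (der_cst h l)) _; ring.
split.
- exact: nbhs_singleton nJ.
- have := derM (@der_comp _ f (fun l => l * h) _ _ _ d0 dl) (der_cst h^-1 l).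
  by move=> H; apply: is_derive_eq H _; field; rewrite gt_eqF.
- have H := @der_comp _ (deriven_on J 1 f) (fun l => l * h) _ _ _ d1 dl.
  by apply: is_derive_eq H _; rewrite mulrC.
Qed.

(** Each differentiation of f (l h) / h in l multiplies by h: the first
    derivative is bounded and the second is of order h. *)
Definition scaled_C2 (J : set R) (M h : R) (f : R -> R) := forall l : R, `|l| < 2 ->
  [/\ is_derive l 1 (fun l => f (l * h) / h) (deriven_on J 1 f (l * h)),
    is_derive l 1 (fun l => deriven_on J 1 f (l * h)) (h * deriven_on J 2 f (l * h)),
    `|deriven_on J 1 f (l * h)| <= M & `|h * deriven_on J 2 f (l * h)| <= M * h].

Lemma near_scaled_C2 (delta : R) F c (J := [set` `[- delta, delta]]) : 0 < delta ->
  (\forall h \near 0^'+, smooth_on J (F h)) -> has_expansion J F c ->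
  exists M : R, \forall h \near 0^'+, scaled_C2 J M h (F h).
Proof.
move=> delta0 sm ex.
have [C1 hC1] := has_expansion_deriv_bounded 1 ex.
have [C2 hC2] := has_expansion_deriv_bounded 2 ex.
exists (Num.max C1 C2); near=> h => l l2.
have h0 : 0 < h by near: h; exact: nbhs_right_gt.
have hd : h * 2 < delta by rewrite -ltr_pdivlMr//; near: h; apply: nbhs_right_lt; rewrite divr_gt0.
have sh : smooth_on J (F h) by near: h; exact: sm.
have b1 : forall E, J E -> `|deriven_on J 1 (F h) E| <= C1 by near: h; exact: hC1.
have b2 : forall E, J E -> `|deriven_on J 2 (F h) E| <= C2 by near: h; exact: hC2.
have [Jl d1 d2] := scaled_derivatives h0 hd sh l2; split => //.
- by rewrite le_max b1.
- rewrite normrM (gtr0_norm h0) mulrC ler_wpM2r ?(ltW h0)//.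
  by rewrite le_max (b2 _ Jl) orbT.
Unshelve. all: by end_near. Qed.

Lemma between_lt (a b z r : R) : `|a| < r -> `|b| < r ->
  Num.min a b <= z <= Num.max a b -> `|z| < r.
Proof.
rewrite !ltr_norml => /andP[a1 a2] /andP[b1 b2] /andP[z1 z2].
by rewrite (lt_le_trans _ z1) ?lt_min ?a1 ?b1// (le_lt_trans z2)// gt_max a2 b2.
Qed.

(** The derivative of eps is uniformly close to that of its leading
    coefficient, which is continuous and takes the value d0 at 0. *)
Lemma leading_slope (delta d0 : R) (eps : R -> R -> R) (ceps : nat -> R -> R) :
  0 < delta -> 0 < d0 ->
  (\forall h \near 0^'+, smooth_on [set` `[- delta, delta]] (eps h)) ->
  has_expansion [set` `[- delta, delta]] eps ceps ->
  derive_on [set` `[- delta, delta]] (ceps 0%N) 0 = d0 ->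
  \forall h \near 0^'+, forall l : R, `|l| < 2 ->
    d0 / 2 <= deriven_on [set` `[- delta, delta]] 1 (eps h) (l * h).
Proof.
set J := [set` _] => delta0 d00 sme expe e0.
have [C hC] := has_expansion_leading 1 expe.
have sc : smooth_on J (ceps 0%N) by case: expe.
have J0 : nbhs (0 : R) J by apply: nbhs_segment; rewrite normr0.
have cc := is_derive_continuous (smooth_on_is_derive 1 J0 sc).
have : \forall E \near (0 : R), `|deriven_on J 1 (ceps 0%N) 0 - deriven_on J 1 (ceps 0%N) E| < d0 / 4.
  by move/cvgrPdist_lt : cc; apply; rewrite divr_gt0.
rewrite [deriven_on J 1 (ceps 0%N) 0]e0 => /nbhs_norm0P[r /= r0 hr].
(* The threshold on h that makes C h at most d0 / 4. *)
have CC0 : 0 < 4 * (`|C| + 1) / d0 by rewrite divr_gt0// mulr_gt0// ltr_wpDl.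
near=> h => l l2.
have h0 : 0 < h by near: h; exact: nbhs_right_gt.
have hd : h * 2 < delta by rewrite -ltr_pdivlMr//; near: h; apply: nbhs_right_lt; rewrite divr_gt0.
have hr2 : h * 2 < r by rewrite -ltr_pdivlMr//; near: h; apply: nbhs_right_lt; rewrite divr_gt0.
have hC4 : h * (4 * (`|C| + 1) / d0) < 1.
  by rewrite -ltr_pdivlMr// mul1r; near: h; apply: nbhs_right_lt; rewrite invr_gt0.
have seps : smooth_on J (eps h) by near: h.
have hCh : forall E, J E -> `|deriven_on J 1 (fun E' => eps h E' - ceps 0%N E') E| <= C * h by near: h.
have lh : `|l * h| < h * 2 by rewrite normrM (gtr0_norm h0) mulrC ltr_pM2l.
have nJ : nbhs (l * h) J := nbhs_segment (lt_trans lh hd).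
have := hr (l * h) (lt_trans lh hr2).
have := hCh (l * h) (nbhs_singleton nJ).
rewrite {1}/deriven_on/= (derive_onE nJ (derB (smooth_on_is_derive 0 nJ seps) (smooth_on_is_derive 0 nJ sc))).
rewrite ler_norml ltr_norml => /andP[a1 _] /andP[_ a2].
have {a1} q1 : - (C * h) <= deriven_on J 1 (eps h) (l * h) - deriven_on J 1 (ceps 0%N) (l * h) := a1.
have {a2} q2 : d0 - deriven_on J 1 (ceps 0%N) (l * h) < d0 / 4 := a2.
have : C * h <= d0 / 4.
  apply: (@le_trans _ _ ((`|C| + 1) * h)).
    by rewrite ler_wpM2r ?ltW//; have := ler_norm C; lra.
  have -> : d0 / 4 = (d0 / 4) * 1 by rewrite mulr1.
  have -> : (`|C| + 1) * h = d0 / 4 * (h * (4 * (`|C| + 1) / d0)).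
    by field; rewrite gt_eqF.
  by rewrite ler_wpM2l ?ltW// divr_gt0.
by move=> q3; change (d0 / 2 <= deriven_on J 1 (eps h) (l * h)); lra.
Unshelve. all: by end_near. Qed.

Lemma near_ln_small (A : R) : \forall h \near 0^'+, A <= `|ln h|.
Proof.
near=> h.
have h1 : h < 1 by near: h; apply: nbhs_right_lt.
have h0 : 0 < h by near: h; exact: nbhs_right_gt.
have : ln h <= - A by near: h; move/cvgrNyPle : (@lnNy R); apply.
by rewrite ler0_norm; [lra | apply: ln_le0; lra].
Unshelve. all: by end_near. Qed.

Lemma mul_ln_le1 h : 0 < h -> h < 1 -> h * `|ln h| <= 1.
Proof.
move=> h0 h1; rewrite ler0_norm; last by apply: ln_le0; lra.
have hi : 0 < h^-1 by rewrite invr_gt0.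
have := ltW (ln_sublinear hi); rewrite lnV ?posrE// => H.
by rewrite -(mulfV (lt0r_neq0 h0)) ler_wpM2l// ltW.
Qed.

(** At l = 0 the leading coefficient vanishes and leaves O(h) / h; the bounded
    slope does the rest. *)
Lemma near_action_bounded (delta : R) (eps : R -> R -> R) (ceps : nat -> R -> R)
    (J := [set` `[- delta, delta]]) :
  0 < delta -> (\forall h \near 0^'+, smooth_on J (eps h)) ->
  has_expansion J eps ceps -> ceps 0%N 0 = 0 ->
  exists M : R, \forall h \near 0^'+, forall l : R, `|l| < 2 -> `|eps h (l * h) / h| <= M.
Proof.
move=> delta0 sm ex e0.
have [C hC] := has_expansion_leading 0 ex.
have [M hM] := near_scaled_C2 delta0 sm ex.
have J0 : J 0 by apply: nbhs_singleton; apply: nbhs_segment; rewrite normr0.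
exists (C + M * 2); near=> h => l l2.
have h0 : 0 < h by near: h; exact: nbhs_right_gt.
have b0 : forall E, J E -> `|eps h E - ceps 0%N E| <= C * h by near: h; exact: hC.
have hMh : scaled_C2 J M h (eps h).
  by near: h; exact: hM.
have z2 : `|0 : R| < 2 by rewrite normr0.
have M0 : 0 <= M by have [_ _ + _] := hMh 0 z2; exact: le_trans.
rewrite -(subrK (eps h (0 * h) / h) (eps h (l * h) / h)) addrC.
apply: (le_trans (ler_normD _ _)); apply: lerD.
  rewrite mul0r normrM normfV (gtr0_norm h0) ler_pdivrMr//.
  by have := b0 0 J0; rewrite e0 subr0.
apply: (@le_trans _ _ (M * `|l - 0|)); last by rewrite subr0 ler_wpM2l// ltW.
apply: (@mvt_bound _ (fun l => eps h (l * h) / h)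
  (fun l => deriven_on J 1 (eps h) (l * h))) => z /(between_lt z2 l2) zz;
  by have [] := hMh z zz.
Unshelve. all: by end_near. Qed.

(** The slope c |t| of the term X t outweighs the bound K on the rest as soon
    as |t| >= 2 K / c, while the Lipschitz constants add up. *)
Lemma dominant_term (Y X X1 X2 : R -> R) (t c K M : R) :
  0 < c -> t <= 0 -> 2 * K / c <= `|t| ->
  (forall l : R, `|l| < 2 -> [/\ is_derive l 1 X (X1 l), is_derive l 1 X1 (X2 l),
     c <= X1 l & `|X2 l * t| <= M]) ->
  C2_bounded K (fun l => Y l - X l * t) ->
  exists Y1 : R -> R,
    [/\ forall l : R, `|l| < 2 -> is_derive l 1 Y (Y1 l),
      forall l : R, `|l| < 2 -> Y1 l <= - (c / 2 * `|t|) &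
      forall l m : R, `|l| < 2 -> `|m| < 2 -> `|Y1 m - Y1 l| <= (K + M) * `|m - l|].
Proof.
move=> c0 t0 tK hX [Z1 [Z2 hZ]].
pose Y1 l := Z1 l + X1 l * t.
exists Y1; split.
- move=> l l2; have [dz _ _ _] := hZ l l2; have [dx _ _ _] := hX l l2.
  have := derD dz (derM dx (der_cst t l)); rewrite mulr0 addr0.
  rewrite (_ : (fun y => _) = Y)//.
  by apply/funext => y; rewrite subrK.
- move=> l l2; have [_ _ z1 _] := hZ l l2; have [_ _ x1 _] := hX l l2.
  have KL : K <= c / 2 * `|t|.
    have -> : K = c / 2 * (2 * K / c) by field; rewrite gt_eqF.
    by rewrite ler_wpM2l// divr_ge0// ltW.
  have z1' : Z1 l <= K := le_trans (ler_norm _) z1.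
  rewrite ler0_norm// in KL *.
  have : X1 l * t <= c * t by rewrite ler_wnM2r.
  rewrite /Y1; lra.
- move=> l m l2 m2.
  apply: (@mvt_bound _ Y1 (fun l => Z2 l + X2 l * t)) => z /(between_lt l2 m2) z2;
    have [_ dz _ z2'] := hZ z z2; have [_ dx _ x2] := hX z z2.
    by have := derD dz (derM dx (der_cst t z)); rewrite mulr0 addr0; exact.
  by apply: (le_trans (ler_normD _ _)); apply: lerD.
Qed.

(** Here t = ln h: the second derivative of the singular term is of order
    h |ln h|, hence bounded. *)
Lemma calY_derivative_bounds (delta d0 : R) (eps Sp Sm : R -> R -> R)
    (ceps cSp cSm : nat -> R -> R) (arg : R -> R)
    (J := [set` `[- delta, delta]]) :
  0 < delta -> 0 < d0 ->
  (\forall h \near 0^'+,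
     [/\ smooth_on J (eps h), smooth_on J (Sp h) & smooth_on J (Sm h)]) ->
  has_expansion J eps ceps -> has_expansion J Sp cSp -> has_expansion J Sm cSm ->
  ceps 0%N 0 = 0 -> derive_on J (ceps 0%N) 0 = d0 ->
  is_arg_Gamma_half arg ->
  exists c K : R, 0 < c /\ \forall h \near 0^'+,
    exists Y1 : R -> R,
    [/\ forall l : R, `|l| < 2 -> is_derive l 1 (calY arg h (eps h) (Sp h) (Sm h)) (Y1 l),
      forall l : R, `|l| < 2 -> Y1 l <= - (c * `|ln h|) &
      forall l m : R, `|l| < 2 -> `|m| < 2 -> `|Y1 m - Y1 l| <= K * `|m - l|].
Proof.
move=> delta0 d00 sm expe expp expm e0 e1 harg.
have sme : \forall h \near 0^'+, smooth_on J (eps h) by apply: filterS sm => h [].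
have smp : \forall h \near 0^'+, smooth_on J (Sp h) by apply: filterS sm => h [].
have smm : \forall h \near 0^'+, smooth_on J (Sm h) by apply: filterS sm => h [].
have slope := leading_slope delta0 d00 sme expe e1.
have [Mx hMx] := near_action_bounded delta0 sme expe e0.
have [Me hMe] := near_scaled_C2 delta0 sme expe.
have [Mp hMp] := near_scaled_C2 delta0 smp expp.
have [Mm hMm] := near_scaled_C2 delta0 smm expm.
pose M := Num.max 1 (Num.max Mx (Num.max Me (Num.max Mp Mm))).
have [M1 MxM MeM MpM MmM] : [/\ 1 <= M, Mx <= M, Me <= M, Mp <= M & Mm <= M].
  by rewrite /M !le_max !lexx !orbT.
clearbody M.
have mkC2 (F : R -> R -> R) N : N <= M ->
    (\forall h \near 0^'+, scaled_C2 J N h (F h)) ->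
    \forall h \near 0^'+, C2_bounded M (fun l => F h (l * h) / h).
  move=> NM hF; near=> h.
  have h1 : h < 1 by near: h; exact: nbhs_right_lt.
  have h0 : 0 < h by near: h; exact: nbhs_right_gt.
  exists (fun l => deriven_on J 1 (F h) (l * h)), (fun l => h * deriven_on J 2 (F h) (l * h)).
  have Mh : N * h <= M.
    apply: (@le_trans _ _ (M * h)); first by rewrite ler_wpM2r// ltW.
    by rewrite ler_piMr ?ltW//; exact: lt_le_trans ltr01 M1.
  have hFh : scaled_C2 J N h (F h) by near: h; exact: hF.
  move=> l l2; have [a1 a2 a3 a4] := hFh l l2.
  by split => //; [exact: le_trans NM|exact: le_trans Mh].
have De := mkC2 _ _ MeM hMe.
have Dp := mkC2 _ _ MpM hMp.
have Dm := mkC2 _ _ MmM hMm.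
have [K hK] := calY_split harg M1.
exists (d0 / 4), (K + Me); split; first by rewrite divr_gt0.
near=> h.
have h0 : 0 < h by near: h; exact: nbhs_right_gt.
have h1 : h < 1 by near: h; exact: nbhs_right_lt.
have Lbig : 4 * K / d0 <= `|ln h| by near: h; exact: near_ln_small.
have slopeh : forall l : R, `|l| < 2 -> d0 / 2 <= deriven_on J 1 (eps h) (l * h).
  by near: h; exact: slope.
have hMeh : scaled_C2 J Me h (eps h).
  by near: h; exact: hMe.
have Xb : forall l : R, `|l| < 2 -> `|eps h (l * h) / h| <= M.
  by near: h; apply: filterS hMx => h hh l l2; exact: le_trans (hh l l2) MxM.
have Deh : C2_bounded M (fun l => eps h (l * h) / h) by near: h; exact: De.
have Dph : C2_bounded M (fun l => Sp h (l * h) / h) by near: h; exact: Dp.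
have Dmh : C2_bounded M (fun l => Sm h (l * h) / h) by near: h; exact: Dm.
have [Z1 [Z2 hZ]] := hK h (eps h) (Sp h) (Sm h) Deh Xb Dph Dmh.
rewrite (_ : d0 / 4 = d0 / 2 / 2); last by field.
apply: (@dominant_term _ _ (fun l => deriven_on J 1 (eps h) (l * h))
  (fun l => h * deriven_on J 2 (eps h) (l * h)) _ _ _ _ _ _ _ _ (hK h _ _ _ Deh Xb Dph Dmh)).
- by rewrite divr_gt0.
- by rewrite ln_le0// ltW.
- by rewrite (_ : 2 * K / (d0 / 2) = 4 * K / d0)//; field; rewrite gt_eqF.
- move=> l l2; have [a1 a2 a3 a4] := hMeh l l2; split => //; first exact: slopeh.
  rewrite normrM; apply: (@le_trans _ _ (Me * h * `|ln h|)); first by rewrite ler_wpM2r.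
  by rewrite -mulrA ler_piMr ?mul_ln_le1// (le_trans _ a3).
Unshelve. all: by end_near. Qed.

End Expansion.

(** * Derivatives of the inverse function *)

Lemma near_within_dnbhs {R : realType} (S : set R) (x : R) (P : R -> Prop) :
  (\forall y \near x, y != x -> S y -> P y) -> \forall y \near within S x^', P y.
Proof. by []. Qed.

Lemma lipschitz_const_ge0 {R : realType} (f : R -> R) (K : R) :
  (forall l m : R, `|l| < 2 -> `|m| < 2 -> `|f m - f l| <= K * `|m - l|) ->
  0 <= K.
Proof.
have h1 : `|1 : R| < 2 by rewrite normr1 ltr1n.
have h0 : `|0 : R| < 2 by rewrite normr0.
move=> /(_ 0 1 h0 h1); rewrite subr0 normr1 mulr1; exact: le_trans.
Qed.

Section Inverse.
Context {R : realType} (Y Y1 : R -> R) (c K : R) (c0 : 0 < c).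
Context (dY : forall l : R, `|l| < 2 -> is_derive l 1 Y (Y1 l)).
Context (Y1_le : forall l : R, `|l| < 2 -> Y1 l <= - c).
Context (Y1_lip : forall l m : R,
  `|l| < 2 -> `|m| < 2 -> `|Y1 m - Y1 l| <= K * `|m - l|).

Local Notation A := (calA Y).
Local Notation S := (imY Y).
Local Notation I := (`[-1, 1]%classic : set R).

Lemma norm_lt2 (a : R) : I a -> `|a| < 2.
Proof. by rewrite /= in_itv/= => /andP[h1 h2]; rewrite ltr_norml; apply/andP; split; lra. Qed.

Lemma Y_slope a b : I a -> I b ->
  exists2 z : R, `|z| < 2 /\ `|z - a| <= `|b - a| & Y b - Y a = Y1 z * (b - a).
Proof.
move=> Ia Ib; have a2 := norm_lt2 Ia; have b2 := norm_lt2 Ib.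
have [z zab E] := @mvt_between _ Y Y1 a b (fun z h => dY (between_lt a2 b2 h)).
exists z => //; split; first exact: between_lt a2 b2 zab.
move: zab; rewrite ge_min le_max => /andP[/orP[h1|h1] /orP[h2|h2]];
  rewrite ler_norml; have := ler_norm (b - a); have := ler_norm (- (b - a));
  rewrite normrN => ? ?; apply/andP; split; lra.
Qed.

Lemma Y1_norm_ge l : `|l| < 2 -> c <= `|Y1 l|.
Proof. by move=> l2; have := Y1_le l2; have := ler_norm (- Y1 l); rewrite normrN; lra. Qed.

Lemma Y_expanding a b : I a -> I b -> c * `|b - a| <= `|Y b - Y a|.
Proof.
move=> Ia Ib; have [z [z2 _] ->] := Y_slope Ia Ib.
by rewrite normrM ler_wpM2r// Y1_norm_ge.
Qed.

Lemma Y_inj : {in I &, injective Y}.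
Proof.
move=> a b; rewrite !inE => Ia Ib E; apply/esym/eqP; rewrite -subr_eq0 -normr_eq0.
have := Y_expanding Ia Ib; rewrite E subrr normr0 => h.
by have := normr_ge0 (b - a); rewrite eq_le => ->; rewrite andbT -(pmulr_rle0 _ c0).
Qed.

Lemma calA_Y a : I a -> A (Y a) = a.
Proof. by move=> Ia; apply: (pinvKV (fun=> 0) Y_inj); rewrite inE. Qed.

(** The image has no isolated point, so that the limits that define
    [derive_on] are unique. *)
Lemma within_image_proper a : I a -> ProperFilter (within S (Y a)^').
Proof.
move=> Ia; apply: Build_ProperFilter.
rewrite /within /dnbhs /within/= => hP.
have cY := is_derive_continuous (dY (norm_lt2 Ia)).
have /nbhs_ballP[r /= r0 hr] : \forall b \near a, Y b != Y a -> S (Y b) -> False by exact: (cY _ hP).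
pose s := Num.min (r / 2) 1.
have s0 : 0 < s by rewrite lt_min ltr01 divr_gt0.
have s1 : s <= 1 by rewrite ge_min lexx orbT.
have sr : s < r.
  by apply: (@le_lt_trans _ _ (r / 2)); [rewrite ge_min lexx|rewrite ltr_pdivrMr// ltr_pMr// ltr1n].
(* A point of [-1, 1] at distance s from a: move towards the centre. *)
have [b Ib ba] : exists2 b, I b & `|a - b| = s.
  move: Ia; rewrite /= in_itv/= => /andP[h1 h2].
  have [a0|a0] := leP a 0.
    exists (a + s); first by rewrite /= in_itv/=; apply/andP; split; lra.
    by rewrite opprD addNKr normrN gtr0_norm.
  exists (a - s); first by rewrite /= in_itv/=; apply/andP; split; lra.
  by rewrite opprB addrC subrK gtr0_norm.
apply: (hr b); first by rewrite /ball/= ba.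
  apply/eqP => /(Y_inj (mem_set Ib) (mem_set Ia)) E.
  by move: ba s0; rewrite E subrr normr0 => <-; rewrite ltxx.
by exists b.
Qed.

(** By the mean value theorem, the difference quotient of the inverse between
    Y a and Y b is 1 / Y1 z for some z between a and b, and |Y1 z - Y1 a| is at
    most K |b - a| <= (K / c) |Y b - Y a|. *)
Lemma derive_calA a : I a -> derive_on S A (Y a) = (Y1 a)^-1.
Proof.
move=> Ia; have a2 := norm_lt2 Ia.
have PF := within_image_proper Ia.
have K0 := lipschitz_const_ge0 Y1_lip.
have est b : I b -> Y b != Y a -> `|(Y1 a)^-1 - diffq A (Y a) (Y b)| <= K / c ^+ 3 * `|Y b - Y a|.
  move=> Ib ba; rewrite /diffq !calA_Y//.
  have [z [z2 za] E] := Y_slope Ia Ib.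
  have ez := Y1_norm_ge z2; have ea := Y1_norm_ge a2.
  have z0 : Y1 z != 0 by rewrite -normr_gt0; apply: lt_le_trans ez.
  have a0 : Y1 a != 0 by rewrite -normr_gt0; apply: lt_le_trans ea.
  have ba0 : b - a != 0 by apply: contra ba; rewrite subr_eq0 => /eqP ->.
  rewrite E (_ : (Y1 a)^-1 - _ = (Y1 z - Y1 a) / (Y1 a * Y1 z)); last first.
    by field; rewrite z0 a0 ba0.
  rewrite -E normrM normfV normrM.
  have Eb := Y_expanding Ia Ib.
  have lip : `|Y1 z - Y1 a| <= K * (`|Y b - Y a| / c).
    apply: (le_trans (Y1_lip a2 z2)); rewrite ler_wpM2l//.
    by apply: (le_trans za); rewrite ler_pdivlMr// mulrC.
  have den : (`|Y1 a| * `|Y1 z|)^-1 <= (c * c)^-1.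
    by rewrite lef_pV2 ?posrE ?mulr_gt0 ?normr_gt0// ler_pM ?(ltW c0).
  apply: (@le_trans _ _ (K * (`|Y b - Y a| / c) * (c * c)^-1)).
    by rewrite ler_pM// invr_ge0 mulr_ge0.
  by rewrite le_eqVlt; apply/orP; left; apply/eqP; field; rewrite gt_eqF.
apply: cvg_lim => //; apply/cvgrPdist_le => e e0.
have C0 : 0 < K / c ^+ 3 + 1 by rewrite ltr_wpDl// divr_ge0// exprn_ge0// ltW.
have : \forall y \near Y a, `|y - Y a| < e / (K / c ^+ 3 + 1).
  have := nbhsx_ballx (Y a) _ (divr_gt0 e0 C0); apply: filterS => y.
  by rewrite /ball/= distrC.
move=> near_e; apply: near_within_dnbhs; move: near_e; apply: filterS => y hy yY [b Ib Yb].
rewrite -Yb in hy yY *; apply: le_trans (est b Ib yY) _.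
move/ltW: hy; rewrite ler_pdivlMr//; apply: le_trans.
by rewrite mulrC ler_wpM2l// lerDl.
Qed.

(** This is A'' / A' = - Y'' / Y'^2 in finite differences: the quotients that
    converge to A'' are A' (Y1 a - Y1 b) / (Y1 b (Y b - Y a)), where the
    numerator is at most K |b - a| and |Y b - Y a| >= c |b - a|. *)
Lemma second_derivative_calA a : I a ->
  `|deriven_on S 2 A (Y a)| <= K / c ^+ 2 * `|deriven_on S 1 A (Y a)|.
Proof.
move=> Ia; have a2 := norm_lt2 Ia.
have PF := within_image_proper Ia.
have K0 := lipschitz_const_ge0 Y1_lip.
rewrite [deriven_on S 1 A _](derive_calA Ia).
have est b : I b -> Y b != Y a ->
    `|diffq (derive_on S A) (Y a) (Y b)| <= K / c ^+ 2 * `|(Y1 a)^-1|.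
  move=> Ib ba; rewrite /diffq !derive_calA//.
  have b2 := norm_lt2 Ib.
  have eb := Y1_norm_ge b2; have ea := Y1_norm_ge a2.
  have b0 : Y1 b != 0 by rewrite -normr_gt0; apply: lt_le_trans eb.
  have a0 : Y1 a != 0 by rewrite -normr_gt0; apply: lt_le_trans ea.
  have ba0 : Y b - Y a != 0 by rewrite subr_eq0.
  rewrite (_ : _ / _ = (Y1 a)^-1 * ((Y1 a - Y1 b) / (Y1 b * (Y b - Y a)))); last first.
    by field; rewrite b0 a0 ba0.
  rewrite normrM mulrC ler_wpM2r// normrM normfV normrM.
  have Eb := Y_expanding Ia Ib.
  have d0 : 0 < `|Y b - Y a| by rewrite normr_gt0.
  rewrite ler_pdivrMr; last by rewrite mulr_gt0// normr_gt0.
  rewrite distrC; apply: (le_trans (Y1_lip a2 b2)).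
  apply: (@le_trans _ _ (K * (`|Y b - Y a| / c))).
    by rewrite ler_wpM2l// ler_pdivlMr// mulrC.
  rewrite (_ : K * _ = K / c ^+ 2 * (c * `|Y b - Y a|)); last by field; rewrite gt_eqF.
  by rewrite ler_wpM2l ?divr_ge0 ?sqr_ge0// ler_wpM2r.
(* [lim] takes the default value 0 when the second derivative does not exist. *)
have [cv|ncv] := pselect (cvg (diffq (derive_on S A) (Y a) y @[y --> within S (Y a)^'])); last first.
  rewrite [X in `|X|](_ : _ = 0) ?normr0; last exact: dvgP.
  by rewrite mulr_ge0// divr_ge0// sqr_ge0.
apply: (cvgr_to_le (cvg_norm cv)).
apply: near_within_dnbhs; apply: (@filterE _ (nbhs (Y a))) => y yY [b Ib Yb].
by rewrite -Yb in yY *; exact: est.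
Qed.

End Inverse.

(** * Moments of the coefficients *)

Section LatticeSums.
Context {R : realType}.
Implicit Types (u v w : nat -> R) (l : R) (chi : R -> R).

Lemma series_le_bound u (B : R) : (forall n, 0 <= u n) ->
  (forall k, \sum_(0 <= n < k) u n <= B) -> cvgn (series u) /\ limn (series u) <= B.
Proof.
move=> u0 uB.
have cv : cvgn (series u).
  apply: nondecreasing_is_cvgn; first exact: (nondecreasing_series (fun n _ _ => u0 n)).
  by exists B => _ [k _ <-]; exact: uB.
by split => //; apply: limr_le => //; apply: nearW => k; exact: uB.
Qed.

Lemma series_norm_le_bound w v (B : R) : (forall n, `|w n| <= v n) ->
  (forall k, \sum_(0 <= n < k) v n <= B) -> cvgn (series w) /\ `|limn (series w)| <= B.
Proof.
move=> wv vB.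
have nB k : \sum_(0 <= n < k) `|w n| <= B.
  by apply: le_trans (vB k); apply: ler_sum => n _.
have [cn nle] := @series_le_bound (fun n => `|w n|) B (fun n => normr_ge0 _) nB.
have cv : cvgn (series w) by apply: normed_cvg; exact: cn.
by split => //; apply: le_trans nle; exact: lim_series_norm.
Qed.

Lemma le_series_lim u (B : R) k : (forall n, 0 <= u n) ->
  (forall k, \sum_(0 <= n < k) u n <= B) -> \sum_(0 <= n < k) u n <= limn (series u).
Proof.
move=> u0 uB; have [cv _] := series_le_bound u0 uB.
exact: (nondecreasing_cvgn_le (nondecreasing_series (fun n _ _ => u0 n)) cv k).
Qed.

(** Bounding a term by an increment of atan makes the lattice sum telescope.
    The factor 3 absorbs the variation of 1 + z^2 over a step of length at
    most 1. *)
Lemma inv_1Dsqr_le_atan l (u : R) : 1 <= l ->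
  (1 + u ^+ 2)^-1 <= 3 * l * (atan (u + l^-1) - atan u).
Proof.
move=> l1; have l0 : 0 < l by lra.
have li0 : 0 < l^-1 by rewrite invr_gt0.
have li1 : l^-1 <= 1 by rewrite invf_le1.
have [z zb ->] := @mvt_between _ (@atan R) (fun z => (1 + z ^+ 2)^-1) u (u + l^-1)
  (fun z _ => is_derive1_atan z).
have /andP[uz zu] : u <= z <= u + l^-1.
  by move: zb; rewrite min_l ?max_r// lerDl ltW.
have zq : z ^+ 2 <= 2 * u ^+ 2 + 2.
  have e1 : (z - u) * (z - u) <= 1 by apply: mulr_ile1; lra.
  by have := sqr_ge0 (u - (z - u)); rewrite !expr2; lra.
have p1 : 0 < 1 + u ^+ 2 by rewrite ltr_pwDl// sqr_ge0.
have p2 : 0 < 1 + z ^+ 2 by rewrite ltr_pwDl// sqr_ge0.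
have -> : u + l^-1 - u = l^-1 by ring. 
have -> : 3 * l * ((1 + z ^+ 2)^-1 / l) = 3 / (1 + z ^+ 2).
  by field; rewrite !gt_eqF.
by rewrite ler_pdivlMr// ler_pdivrMl//; have := sqr_ge0 u; lra.
Qed.

(** The argument of the profile at the index n, for l = |ln h|^(1 - gamma'). *)
Definition node l (n0 : int) (n : nat) : R := (n%:Z - n0)%:~R / l.

Lemma nodeS l (n0 : int) n : node l n0 n.+1 = node l n0 n + l^-1.
Proof. by rewrite /node intS -addrA (intrD _ 1) mulr1z mulrDl mul1r [LHS]addrC. Qed.

Lemma lattice_sum_le l (n0 : int) k : 1 <= l ->
  \sum_(0 <= n < k) (1 + node l n0 n ^+ 2)^-1 <= 3 * pi * l.
Proof.
move=> l1.
apply: (@le_trans _ _ (\sum_(0 <= n < k) 3 * l * (atan (node l n0 n.+1) - atan (node l n0 n)))).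
  by apply: ler_sum => n _; rewrite nodeS; exact: inv_1Dsqr_le_atan.
rewrite -mulr_sumr (telescope_sumr (fun n => atan (node l n0 n)))//.
rewrite [leRHS]mulrAC ler_wpM2l//; first lra.
have := atan_ltpi2 (node l n0 k); have := atan_gtNpi2 (node l n0 0); lra.
Qed.

Lemma schwartz_decay chi : schwartz chi ->
  exists D : R, forall x, chi x ^+ 2 * (1 + x ^+ 2) ^+ 2 <= D.
Proof.
move=> [_ dec]; have [C0 h0] := dec 0%N 0%N; have [C2 h2] := dec 2%N 0%N.
exists ((C0 + C2) ^+ 2) => x; rewrite -exprMn.
have h : `|chi x * (1 + x ^+ 2)| <= C0 + C2.
  rewrite mulrDr mulr1; apply: (le_trans (ler_normD _ _)); apply: lerD.
    by have := h0 x; rewrite expr0 mul1r.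
  by have := h2 x; rewrite mulrC.
rewrite -[leLHS]real_normK ?num_real// ler_sqr ?nnegrE//.
exact: le_trans h.
Qed.

(** Evenness allows the window to lie on the positive side, where the indices
    close to n0 + l x are nonnegative. *)
Lemma bump_lower chi : smooth chi -> (exists x, chi x != 0) ->
  (forall x, 0 <= chi x) -> (forall x, chi (- x) = chi x) ->
  exists x1 eta c : R, [/\ 0 <= x1, 0 < eta, 0 < c &
    forall x, x1 <= x <= x1 + eta -> c <= chi x].
Proof.
move=> sm [x xn] chi0 even.
have px : 0 < chi `|x|.
  have -> : chi `|x| = chi x by have [?|?] := ger0P x.
  by rewrite lt0r xn chi0.
have cc : {for `|x|, continuous chi}.
  apply: differentiable_continuous; apply/derivable1_diffP; exact: (sm 0%N).
have : \forall y \near `|x|, chi `|x| / 2 < chi y.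
  by apply: (cvgr_gt _ cc); rewrite ltr_pdivrMr// ltr_pMr// ltr1n.
move=> /nbhs_ballP[r /= r0 hr].
exists `|x|, (r / 2), (chi `|x| / 2); split; rewrite ?divr_gt0// => y /andP[h1 h2].
apply: ltW; apply: hr; rewrite /ball/= distrC ger0_norm; lra.
Qed.

(** The window [x1, x1 + eta] contains the rescaled lattice points of about
    l eta indices, all of them nonnegative. *)
Lemma lattice_sum_ge chi (x1 eta c l : R) (n0 : int) : 0 <= x1 -> 0 < eta -> 0 < c ->
  (forall x, x1 <= x <= x1 + eta -> c <= chi x) -> 4 <= l * eta -> 0 < l -> 0 <= n0 ->
  exists k : nat, c ^+ 2 * (eta / 4) * l <= \sum_(0 <= n < k) chi (node l n0 n) ^+ 2.
Proof.
move=> x10 eta0 c0 hc le4 l0; case: n0 => // n0 _.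
(* The indices n0 + p, ..., n0 + p + q - 1 have their nodes in the window. *)
pose p := (Num.truncn (l * x1)).+1; pose q := Num.truncn (l * eta / 2).
have lx0 : 0 <= l * x1 by rewrite mulr_ge0// ltW.
have le0 : 0 <= l * eta / 2 by lra.
have /andP[p1 p2] := truncn_itv lx0; have /andP[q1 q2] := truncn_itv le0.
rewrite -/q in q1 q2; rewrite -[_.+1]/p in p2.
rewrite -[q.+1%:R]natr1 in q2.
have p3 : p%:R <= l * x1 + 1 by rewrite /p -[X in X <= _]natr1; lra.
exists (n0 + p + q)%N.
rewrite (@big_cat_nat _ _ _ (n0 + p))//=; last by rewrite leq_addr.
apply: ler_wpDl; first by apply: sumr_ge0 => n _; exact: sqr_ge0.
apply: (@le_trans _ _ (\sum_(n0 + p <= n < n0 + p + q) c ^+ 2)).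
  by rewrite sumr_const_nat addKn -[leRHS]mulr_natr -mulrA ler_wpM2l ?sqr_ge0//; lra.
apply: ler_sum_nat => n /andP[n1 n2].
have cchi : c <= chi (node l n0 n).
  have nn0 : (n0 <= n)%N := leq_trans (leq_addr _ _) n1.
  have nodeE : node l n0 n * l = (n - n0)%N%:R.
    by rewrite /node divfK ?gt_eqF// subzn.
  have d1 : p%:R <= (n - n0)%N%:R :> R by rewrite ler_nat leq_subRL.
  have d2 : (n - n0)%N%:R <= p%:R + q%:R :> R.
    by rewrite -natrD ler_nat leq_subLR addnA ltnW.
  apply: hc; apply/andP; split; rewrite -(ler_pM2r l0) nodeE; lra.
by rewrite ler_sqr ?nnegrE ?(ltW c0)// (le_trans (ltW c0)).
Qed.

(** Before normalisation the second moment is O(l^3) by the decay of chi and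
    the total mass is at least of order l; normalising divides the former by
    the latter. *)
Lemma coeff_moments chi : schwartz chi -> (exists x, chi x != 0) ->
  (forall x, 0 <= chi x) -> (forall x, chi (- x) = chi x) ->
  exists C l1 : R, forall (gamma' h : R) (n0 : int), let l := `|ln h| `^ (1 - gamma') in
    l1 <= l -> 0 <= n0 ->
    (exists B : R, forall k, \sum_(0 <= n < k) `|coeff chi gamma' h n0 n%:Z| ^+ 2 <= B) /\
    (forall k, \sum_(0 <= n < k)
       `|coeff chi gamma' h n0 n%:Z| ^+ 2 * (n%:Z - n0)%:~R ^+ 2 <= C * l ^+ 2).
Proof.
move=> sch ex chi0 even.
have [D hD] := schwartz_decay sch.
have D0 : 0 <= D by apply: le_trans (hD 0); rewrite mulr_ge0// sqr_ge0.
have [x1 [eta [c [x10 eta0 c0 hc]]]] := bump_lower (proj1 sch) ex chi0 even.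
pose c1 := c ^+ 2 * (eta / 4).
have c10 : 0 < c1 by rewrite mulr_gt0 ?exprn_gt0 ?divr_gt0.
exists (D * (3 * pi) / c1), (Num.max 1 (4 / eta)) => gamma' h n0 l.
rewrite ge_max => /andP[l1 l4] n00.
have l0 : 0 < l by lra.
have {}l4 : 4 <= l * eta by rewrite -ler_pdivrMr.
pose u n := chi (node l n0 n) ^+ 2.
have u0 n : 0 <= u n by exact: sqr_ge0.
have p1 x : 0 < 1 + x ^+ 2 :> R by rewrite ltr_pwDl// sqr_ge0.
have ule n : u n <= D * (1 + node l n0 n ^+ 2)^-1.
  rewrite ler_pdivlMr//; apply: le_trans (hD (node l n0 n)); rewrite ler_wpM2l//.
  by rewrite expr2 ler_peMr ?(ltW (p1 _))// lerDl sqr_ge0.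
have um k : \sum_(0 <= n < k) u n * (n%:Z - n0)%:~R ^+ 2 <= D * (3 * pi) * l ^+ 3.
  apply: (@le_trans _ _ (\sum_(0 <= n < k) (D * l ^+ 2) * (1 + node l n0 n ^+ 2)^-1)).
    apply: ler_sum => n _; have h1 := hD (node l n0 n).
    have -> : (n%:Z - n0)%:~R = l * node l n0 n :> R by rewrite mulrC /node divfK ?gt_eqF.
    rewrite exprMn ler_pdivlMr//.
    apply: (@le_trans _ _ (l ^+ 2 * (u n * (1 + node l n0 n ^+ 2) ^+ 2))); last first.
      by rewrite mulrC ler_wpM2r ?sqr_ge0.
    rewrite [leLHS](_ : _ = l ^+ 2 * (u n * (node l n0 n ^+ 2 * (1 + node l n0 n ^+ 2)))); last by ring.
    rewrite ler_wpM2l ?sqr_ge0// ler_wpM2l// [leRHS]expr2 ler_wpM2r ?(ltW (p1 _))//.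
    by rewrite lerDr.
  rewrite -mulr_sumr; apply: (le_trans (ler_wpM2l _ (lattice_sum_le n0 k l1))).
    by rewrite mulr_ge0// sqr_ge0.
  by rewrite le_eqVlt; apply/orP; left; apply/eqP; ring.
have us k : \sum_(0 <= n < k) u n <= D * (3 * pi * l).
  apply: (@le_trans _ _ (\sum_(0 <= n < k) D * (1 + node l n0 n ^+ 2)^-1)).
    exact: ler_sum.
  by rewrite -mulr_sumr ler_wpM2l// lattice_sum_le.
have [k0 hk0] := lattice_sum_ge x10 eta0 c0 hc l4 l0 n00.
pose T := limn (series u).
have Tge : c1 * l <= T by apply: le_trans hk0 _; exact: le_series_lim.
have T0 : 0 < T by apply: lt_le_trans Tge; rewrite mulr_gt0.
have cE n : `|coeff chi gamma' h n0 n%:Z| ^+ 2 = T^-1 * u n.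
  rewrite /coeff normrM exprMn /Knorm.
  rewrite (_ : (fun n => `|profile chi gamma' h n0 n%:Z| ^+ 2) = u); last first.
    by apply/funext => i; rewrite /u real_normK ?num_real.
  rewrite -/T normfV exprVn real_normK ?num_real// sqr_sqrtr ?(ltW T0)//.
  by rewrite real_normK ?num_real.
split.
  exists (T^-1 * (D * (3 * pi * l))) => k; under eq_bigr do rewrite cE.
  by rewrite -mulr_sumr ler_wpM2l ?invr_ge0 ?(ltW T0).
move=> k; under eq_bigr do rewrite cE -mulrA.
rewrite -mulr_sumr; apply: (le_trans (ler_wpM2l _ (um k))); first by rewrite invr_ge0 ltW.
rewrite mulrC ler_pdivrMr//.
apply: (@le_trans _ _ (D * (3 * pi) / c1 * l ^+ 2 * (c1 * l))).
  by rewrite le_eqVlt; apply/orP; left; apply/eqP; field; rewrite gt_eqF.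
rewrite ler_wpM2l// mulr_ge0 ?sqr_ge0// divr_ge0 ?(ltW c10)// mulr_ge0// mulr_ge0//.
exact: pi_ge0.
Qed.

End LatticeSums.

(** * Perturbation of phases in a series *)

Local Open Scope complex_scope.

Section Complex.
Context {R : realType}.
Implicit Types (x y : R) (z : R[i]).

Lemma periodic_int (f : R -> R) x (k : int) : periodic f (pi *+ 2) ->
  f (x + 2 * pi * k%:~R) = f x.
Proof.
move=> pf.
have E (n : nat) : 2 * pi * n%:R = pi *+ 2 *+ n :> R.
  by rewrite -[RHS]mulr_natr -[pi *+ 2]mulr_natr; ring.
case: k => n; first by rewrite -[(Posz n)%:~R]/(n%:R) E (periodicn pf).
rewrite NegzE rmorphN/= -[(Posz n.+1)%:~R]/(n.+1%:R) mulrN E.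
by rewrite -[in RHS](subrK (pi *+ 2 *+ n.+1) x) (periodicn pf).
Qed.

Lemma expi_periodic x (k : int) : expi (x + 2 * pi * k%:~R) = expi x.
Proof. by rewrite /expi !periodic_int//; [exact: sinD2pi|exact: cosD2pi]. Qed.

Lemma cmodE z : cmod z = Num.sqrt (complex.Re z ^+ 2 + complex.Im z ^+ 2).
Proof. by rewrite /cmod normc_def. Qed.

Lemma normE_cmod z : `|z| = (cmod z)%:C.
Proof. by rewrite cmodE normc_def. Qed.

Lemma cmod_le z : cmod z <= `|complex.Re z| + `|complex.Im z|.
Proof.
have ab0 : 0 <= `|complex.Re z| + `|complex.Im z| by rewrite addr_ge0.
rewrite cmodE -(ger0_norm ab0) -sqrtr_sqr ler_wsqrtr//.
rewrite sqrrD !real_normK ?num_real// -addrA lerD2l lerDr.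
by rewrite mulrn_wge0// mulr_ge0.
Qed.

Lemma cmod_expiM x z : cmod (expi x * z) = cmod z.
Proof.
case: z => a b; rewrite !cmodE /expi/=; congr Num.sqrt.
have := cos2Dsin2 x; set c := cos x; set s := sin x => E.
by rewrite -[RHS]mul1r -E; ring.
Qed.

Lemma cmod_dist (z1 z2 : R[i]) : `|cmod z1 - cmod z2| <= cmod (z1 - z2).
Proof.
have := ler_dist_dist z1 z2.
rewrite !normE_cmod -rmorphB/= lecR; apply: le_trans.
by rewrite [leRHS]cmodE/= [0 ^+ 2]expr0n addr0 sqrtr_sqr.
Qed.

(** The sine and the cosine are 1-Lipschitz, so a perturbation of the phases by
    B m^2 costs B times the second moment in each component. *)
Lemma cseries_sub_le (w m phi psi : nat -> R) (A B D : R) :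
  (forall n, 0 <= w n) -> (forall k, \sum_(0 <= n < k) w n <= A) ->
  (forall k, \sum_(0 <= n < k) w n * m n ^+ 2 <= D) -> 0 <= B ->
  (forall n, `|phi n - psi n| <= B * m n ^+ 2) ->
  cmod (cseries (fun n => (w n)%:C * expi (phi n)) -
        cseries (fun n => (w n)%:C * expi (psi n))) <= 2 * (B * D).
Proof.
move=> w0 wA wD B0 hB.
have part (f df : R -> R) : (forall x, is_derive x 1 f (df x)) ->
    (forall x, `|f x| <= 1) -> (forall x, `|df x| <= 1) ->
    `|limn (series (fun n => w n * f (phi n))) - limn (series (fun n => w n * f (psi n)))| <= B * D.
  move=> dff f1 df1.
  have bnd n y : `|w n * f y| <= w n by rewrite normrM (ger0_norm (w0 n)) ler_piMr.
  have [c1 _] := series_norm_le_bound (fun n => bnd n (phi n)) wA.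
  have [c2 _] := series_norm_le_bound (fun n => bnd n (psi n)) wA.
  rewrite -lim_seriesB//.
  apply: (proj2 (@series_norm_le_bound _ _ (fun n => B * (w n * m n ^+ 2)) _ _ _)) => [n|k].
    rewrite -mulrBr normrM (ger0_norm (w0 n)) mulrCA ler_wpM2l//.
    apply: le_trans (hB n); rewrite -[leRHS]mul1r.
    by apply: (@mvt_bound _ f df) => z _.
  by rewrite -mulr_sumr ler_wpM2l.
have reE (th : nat -> R) : (fun n => complex.Re ((w n)%:C * expi (th n))) = (fun n => w n * cos (th n)).
  by apply/funext => n; rewrite /expi/= mul0r subr0.
have imE (th : nat -> R) : (fun n => complex.Im ((w n)%:C * expi (th n))) = (fun n => w n * sin (th n)).
  by apply/funext => n; rewrite /expi/= mul0r addr0.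
apply: (le_trans (cmod_le _)); rewrite /cseries !reE !imE /= mulr2n mulrDl mul1r.
apply: lerD.
  apply: (part (@cos R) (fun x => - sin x)).
  - exact: cos_max.
  - by move=> x; rewrite normrN sin_max.
apply: (part (@sin R) (@cos R)).
- exact: sin_max.
- exact: cos_max.
Qed.

End Complex.

(** * Revivals *)

Section Revivals.
Context {R : realType}.
Implicit Types (t a b : R) (m n : int).

Definition phase a b t m : R :=
  - (t * (a * (2 * pi * m%:~R) + b * (2 * pi ^+ 2 * m%:~R ^+ 2))).

Lemma phase_Trev a b t m n : b != 0 -> 1 / (pi * b) * a = n%:~R ->
  phase a b (t + 1 / (pi * b)) m = phase a b t m + 2 * pi * (- (n * m + m ^+ 2))%:~R.
Proof.
move=> b0 E; have p0 : pi != 0 :> R by rewrite gt_eqF// pi_gt0.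
rewrite /phase !rmorphN/= rmorphD/= rmorphM/= rmorphXn/= -E.
by move: (pi : R) p0 => p p0; field; rewrite b0 p0.
Qed.

(** Here th is the defect Theta_h: N T_hyp falls short of T_rev by th T_hyp,
    which leaves th 2 pi^2 (b / a) m^2 of the quadratic phase. *)
Lemma phase_multiple_Thyp a b t m (N : int) (th : R) : a != 0 -> b != 0 ->
  1 / (pi * b) * a = N%:~R + th ->
  phase a b (t + N%:~R * (1 / a)) m =
  phase a b t m + th * (2 * pi ^+ 2 * (b / a)) * m%:~R ^+ 2 + 2 * pi * (- (N * m + m ^+ 2))%:~R.
Proof.
move=> a0 b0 E; have p0 : pi != 0 :> R by rewrite gt_eqF// pi_gt0.
rewrite /phase !rmorphN/= rmorphD/= rmorphM/= rmorphXn/=.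
have -> : N%:~R = 1 / (pi * b) * a - th :> R by rewrite E addrK.
by move: (pi : R) p0 => p p0; field; rewrite a0 b0 p0.
Qed.

Lemma atilde2E (Y : R -> R) (c : int -> R) (n0 : int) t :
  atilde2 Y c n0 t = cseries (fun n : nat => (`|c n%:Z| ^+ 2)%:C *
    expi (phase (dA Y n0) (d2A Y n0) t (n%:Z - n0))).
Proof. by []. Qed.

Lemma exact_revival (Y : R -> R) (c : int -> R) (n0 : int) t :
  d2A Y n0 != 0 -> Theta Y n0 = 0 ->
  atilde2 Y c n0 (t + (Nh Y n0)%:~R * Thyp Y n0) = atilde2 Y c n0 (t + Trev Y n0) /\
  atilde2 Y c n0 (t + Trev Y n0) = atilde2 Y c n0 t.
Proof.
rewrite /Theta; set N := Nh Y n0 => b0 /eqP; rewrite subr_eq0 => /eqP.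
rewrite {1}/Trev {1}/Thyp [1 / dA _ _]div1r invrK => E.
have -> : atilde2 Y c n0 (t + Trev Y n0) = atilde2 Y c n0 t.
  rewrite !atilde2E; congr cseries; apply/funext => n; congr (_ * _).
  by rewrite (phase_Trev _ _ b0 E) expi_periodic.
(* If dA vanishes, the convention 1 / 0 = 0 gives T_hyp = 0: the shift is 0. *)
split => //; have [a0|a0] := eqVneq (dA Y n0) 0.
  by rewrite /Thyp a0 invr0 !mulr0 addr0.
rewrite !atilde2E; congr cseries; apply/funext => n; congr (_ * _).
rewrite (@phase_multiple_Thyp _ _ _ _ N 0 a0 b0) ?addr0//.
by rewrite !mul0r addr0 expi_periodic.
Qed.

(** The integer part of the phase shift drops out and the remaining one is at
    most 2 pi^2 B m^2. *)
Lemma approximate_revival (Y : R -> R) (c : int -> R) (n0 : int) t (A D B : R) :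
  d2A Y n0 != 0 -> 0 < Theta Y n0 < 1 ->
  (forall k, \sum_(0 <= n < k) `|c n%:Z| ^+ 2 <= A) ->
  (forall k, \sum_(0 <= n < k) `|c n%:Z| ^+ 2 * (n%:Z - n0)%:~R ^+ 2 <= D) ->
  `|d2A Y n0| <= B * `|dA Y n0| ->
  cmod (atilde2 Y c n0 (t + (Nh Y n0)%:~R * Thyp Y n0) - atilde2 Y c n0 t)
    <= 2 * (2 * pi ^+ 2 * B * D).
Proof.
rewrite /Theta; set N := Nh Y n0 => b0 /andP[th0 th1] hA hD hB.
set th := _ - _ in th0 th1.
have a0 : dA Y n0 != 0.
  apply/eqP => a0; move: hB b0; rewrite a0 normr0 mulr0 normr_le0.
  by move=> ->.
have E : 1 / (pi * d2A Y n0) * dA Y n0 = N%:~R + th.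
  by rewrite /th /Trev /Thyp [1 / dA _ _]div1r invrK addrC subrK.
have pp : 0 <= 2 * pi ^+ 2 :> R by rewrite mulr_ge0// sqr_ge0.
have ba : `|d2A Y n0 / dA Y n0| <= B.
  by rewrite normrM normfV ler_pdivrMr// normr_gt0.
have B0 : 0 <= B := le_trans (normr_ge0 _) ba.
rewrite !atilde2E.
have -> : (fun n : nat => (`|c n%:Z| ^+ 2)%:C *
    expi (phase (dA Y n0) (d2A Y n0) (t + N%:~R * Thyp Y n0) (n%:Z - n0))) =
  (fun n : nat => (`|c n%:Z| ^+ 2)%:C *
    expi (phase (dA Y n0) (d2A Y n0) t (n%:Z - n0) +
      th * (2 * pi ^+ 2 * (d2A Y n0 / dA Y n0)) * (n%:Z - n0)%:~R ^+ 2)).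
  apply/funext => n; congr (_ * _).
  by rewrite (phase_multiple_Thyp _ _ a0 b0 E) expi_periodic.
apply: (@cseries_sub_le _ _ (fun n : nat => (n%:Z - n0)%:~R) _ _ A) => //.
- by rewrite mulr_ge0.
- move=> n; rewrite addrAC subrr add0r normrM (ger0_norm (sqr_ge0 _)) ler_wpM2r ?sqr_ge0//.
  rewrite normrM (ger0_norm (ltW th0)) normrM (ger0_norm pp).
  apply: (@le_trans _ _ (1 * (2 * pi ^+ 2 * `|d2A Y n0 / dA Y n0|))).
    by apply: ler_wpM2r; [exact: mulr_ge0|exact: ltW].
  by rewrite mul1r ler_wpM2l.
Qed.

Lemma near_powR_ln_large (s A : R) : 0 < s -> \forall h \near 0^'+, A <= `|ln h| `^ s.
Proof.
move=> s0; near=> h.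
have hL : Num.max 1 A `^ s^-1 <= `|ln h| by near: h; exact: near_ln_small.
have M0 : 0 <= Num.max 1 A by rewrite le_max ler01.
apply: (@le_trans _ _ ((Num.max 1 A `^ s^-1) `^ s)).
  by rewrite -powRrM mulVf ?gt_eqF// powRr1// le_max lexx orbT.
by rewrite ge0_ler_powR ?nnegrE ?powR_ge0// ltW.
Unshelve. all: by end_near. Qed.

End Revivals.

Theorem theorem6p7 (R : realType) (V : R -> R) (delta : R)
    (eps Sp Sm : R -> R -> R) (ceps cSp cSm : nat -> R -> R) (arg : R -> R)
    (E N : R) (n0 : R -> int) (chi : R -> R) (gamma gamma' : R)
    (Y := fun h : R => calY arg h (eps h) (Sp h) (Sm h))
    (a := fun h : R => coeff chi gamma' h (n0 h))
    (J := [set` `[- delta, delta]])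
    (U := [set h : R | is_unique_minimizer (Y h) h E (n0 h)]) :
  is_potential V ->
  0 < delta ->
  (\forall h \near 0^'+,
     [/\ smooth_on J (eps h), smooth_on J (Sp h) & smooth_on J (Sm h)]) ->
  has_expansion J eps ceps ->
  has_expansion J Sp cSp ->
  has_expansion J Sm cSm ->
  ceps 0%N 0 = 0 ->
  derive_on J (ceps 0%N) 0 = 1 / Num.sqrt (- derive1n 2 V 0) ->
  is_arg_Gamma_half arg ->
  -1 <= E <= 1 ->
  0 < N ->
  h * (n0 h)%:~R @[h --> within U 0^'+] --> N ->
  schwartz chi ->
  (exists x : R, chi x != 0) ->
  (forall x : R, 0 <= chi x) ->
  (forall x : R, chi (- x) = chi x) ->
  0 <= gamma' < 1 ->
  gamma < 1 ->
  1 < gamma + gamma' ->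
  (\forall h \near 0^'+,
     U h -> d2A (Y h) (n0 h) != 0 -> Theta (Y h) (n0 h) = 0 ->
     forall t : R, 0 <= t ->
       atilde2 (Y h) (a h) (n0 h)
         (t + (Nh (Y h) (n0 h))%:~R * Thyp (Y h) (n0 h)) =
       atilde2 (Y h) (a h) (n0 h) (t + Trev (Y h) (n0 h)) /\
       atilde2 (Y h) (a h) (n0 h) (t + Trev (Y h) (n0 h)) =
       atilde2 (Y h) (a h) (n0 h) t) /\
  (exists C : R, \forall h \near 0^'+,
     U h -> d2A (Y h) (n0 h) != 0 -> 0 < Theta (Y h) (n0 h) < 1 ->
     forall t : R, 0 <= t ->
       cmod (atilde2 (Y h) (a h) (n0 h)
               (t + (Nh (Y h) (n0 h))%:~R * Thyp (Y h) (n0 h)) -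
             atilde2 (Y h) (a h) (n0 h) t)
         <= C * (1 / `|ln h| `^ (2 - 2 * gamma)) /\
       `|cmod (a2 (Y h) (a h) (n0 h)
                 (t + (Nh (Y h) (n0 h))%:~R * Thyp (Y h) (n0 h))) -
         cmod (a2 (Y h) (a h) (n0 h) t)|
         <= C * (1 / `|ln h| `^ (2 - 2 * gamma))).
Proof.
move=> potV delta0 sm expe expp expm e0 e1 harg _ N0 hN sch chin chi0 even.
move=> /andP[g0 g1] gam1 gg; split.
  by apply: nearW => h _ b0 Th t _; exact: exact_revival.
have d00 : 0 < 1 / Num.sqrt (- derive1n 2 V 0).
  by rewrite divr_gt0// sqrtr_gt0 oppr_gt0; exact: potential_d2 potV.
have [c [K [c0 hY]]] := calY_derivative_bounds delta0 d00 sm expe expp expm e0 e1 harg.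
have [D [l1 hD]] := coeff_moments sch chin chi0 even.
have g10 : 0 < 1 - gamma' by rewrite subr_gt0.
exists (2 * (2 * pi ^+ 2 * (K / c ^+ 2) * D)).
have n0pos : \forall h \near 0^'+, U h -> 0 < h * (n0 h)%:~R.
  have H : \forall h \near within U 0^'+, 0 < h * (n0 h)%:~R.
    exact: (cvgr_gt _ hN _ N0).
  exact: H.
near=> h => Uh b0 Th t _.
have h0 : 0 < h by near: h; exact: nbhs_right_gt.
have L1 : 1 <= `|ln h| by near: h; exact: near_ln_small.
have L0 : 0 < `|ln h| by apply: lt_le_trans L1.
have ll : l1 <= `|ln h| `^ (1 - gamma') by near: h; exact: near_powR_ln_large.
have [Y1 [dY Yle Ylip]] : exists Y1 : R -> R,
    [/\ forall l : R, `|l| < 2 -> is_derive l 1 (Y h) (Y1 l),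
      forall l : R, `|l| < 2 -> Y1 l <= - (c * `|ln h|) &
      forall l m : R, `|l| < 2 -> `|m| < 2 -> `|Y1 m - Y1 l| <= K * `|m - l|].
  by near: h; exact: hY.
have n0h : 0 <= n0 h.
  have nU : U h -> 0 < h * (n0 h)%:~R by near: h; exact: n0pos.
  by have := nU Uh; rewrite pmulr_rgt0// ltr0z => /ltW.
have [[A hA] hD2] := hD gamma' h (n0 h) ll n0h.
have cL0 : 0 < c * `|ln h| by rewrite mulr_gt0.
have [[[a0 Ia Ea] _] _] := Uh.
have dd := second_derivative_calA cL0 dY Yle Ylip Ia.
rewrite Ea -[deriven_on _ 2 _ _]/(d2A (Y h) (n0 h)) -[deriven_on _ 1 _ _]/(dA (Y h) (n0 h)) in dd.
have main := approximate_revival t b0 Th hA hD2 dd.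
set L := `|ln h| in L1 L0 dd main *.
set q := L `^ (1 - gamma') in hD2 main.
have q0 : 0 < q by rewrite powR_gt0.
have K0 := lipschitz_const_ge0 Ylip.
have D0 : 0 <= D.
  by have := hD2 0%N; rewrite big_geq// pmulr_lge0// exprn_gt0.
(* The exponents: 2 (1 - gamma') - 2 <= - (2 - 2 gamma) as gamma + gamma' >= 1. *)
have qL : q ^+ 2 / L ^+ 2 <= 1 / L `^ (2 - 2 * gamma).
  rewrite ler_pdivrMr ?exprn_gt0// mulrAC mul1r ler_pdivlMr ?powR_gt0//.
  have -> : L ^+ 2 = L `^ 2 by rewrite powR_mulrn ?(ltW L0).
  rewrite /q !gt0_powRE// -expRM_natl -expRD ler_expR.
  have gg0 : 0 <= gamma + gamma' - 1 by lra.
  have := mulr_ge0 (ln_ge0 L1) gg0; lra.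
have fin : 2 * (2 * pi ^+ 2 * (K / (c * L) ^+ 2) * (D * q ^+ 2)) <=
    2 * (2 * pi ^+ 2 * (K / c ^+ 2) * D) * (1 / L `^ (2 - 2 * gamma)).
  rewrite [leLHS](_ : _ = 2 * (2 * pi ^+ 2 * (K / c ^+ 2) * D) * (q ^+ 2 / L ^+ 2)).
    by rewrite ler_wpM2l// !mulr_ge0 ?sqr_ge0 ?pi_ge0// invr_ge0 sqr_ge0.
  by move: (pi : R) => p; field; rewrite !gt_eqF.
have {}main := le_trans main fin.
split => //.
rewrite /a2; apply: le_trans main; rewrite !cmod_expiM.
exact: cmod_dist.
Unshelve. all: by end_near. Qed.
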